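(* Let $\mathcal M=(M,<,+,0,\ldots)$ be a definably complete locally o-minimal expansion of an ordered group. Let $(X,\tau)$ be a regular, locally definably compact definable topological space, $C$ a definable subset of $X$ closed in $(X,\tau)$, and $x\in C$ a point which is not isolated in $C$. Then there exists a definable curve $\gamma:(0,\infty)\to C\setminus\{x\}$ such that $x\in\operatorname{Conv}_{\mathrm{left}}(\gamma)\cup\operatorname{Conv}_{\mathrm{right}}(\gamma)$.
   Context: ''Definable'' means definable in $\mathcal M$ with parameters. $\mathcal M$ is an expansion of an ordered group with dense order without endpoints; locally o-minimal: for every definable $Y\subseteq M$ and $a\in M$ there is an open interval $I\ni a$ with $Y\cap I$ a finite union of points and open intervals; definably complete: every definable subset of $M$ has sup and inf in $M\cup\{\pm\infty\}$. A definable topological space is a definable set with a topology having a definable family as open base. It (or a definable subset with relative topology) is definably compact if every definable filtered family (for any two members some member lies in their intersection) of nonempty closed subsets has nonempty intersection; it is locally definably compact if each point has a definably compact (definable) neighborhood. A definable curve is a definable, not necessarily continuous, map from an open interval. For $\gamma:(a,b)\to X$: $\operatorname{Conv}_{\mathrm{right}}(\gamma)$ is the set of $y\in X$ such that for every $t\in(a,b)$ and every definable neighborhood $A$ of $y$, $\gamma((t,b))\cap A\ne\emptyset$; $\operatorname{Conv}_{\mathrm{left}}(\gamma)$ likewise with $\gamma((a,t))$. *)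

(* Defs.v *)
From Stdlib Require List.
From mathcomp Require Import all_boot.

Set Implicit Arguments.
Unset Strict Implicit.
Unset Printing Implicit Defensive.

Definition pt (M : Type) (n : nat) := 'I_n -> M.

Definition pt1 (M : Type) (a : M) : pt M 1 := fun _ => a.

(* (x, y) in M^(n+1) for x in M^n, y in M (y is the last coordinate) *)
Definition ext (M : Type) (n : nat) (x : pt M n) (y : M) : pt M n.+1 :=
  fun i => match unlift ord_max i with Some j => x j | None => y end.

Definition lsplit (M : Type) (p n : nat) (z : pt M (p + n)) : pt M p :=
  fun i => z (lshift n i).
Definition rsplit (M : Type) (p n : nat) (z : pt M (p + n)) : pt M n :=
  fun j => z (rshift p j).

Record ordered_group (M : Type) (lt : M -> M -> Prop) (add : M -> M -> M)
    (zero : M) : Prop := {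
  og_irrefl : forall x, ~ lt x x;
  og_trans : forall x y z, lt x y -> lt y z -> lt x z;
  og_total : forall x y, lt x y \/ x = y \/ lt y x;
  og_assoc : forall x y z, add x (add y z) = add (add x y) z;
  og_zerol : forall x, add zero x = x;
  og_zeror : forall x, add x zero = x;
  og_inv : forall x, exists y, add x y = zero /\ add y x = zero;
  og_monol : forall x y z, lt x y -> lt (add z x) (add z y);
  og_monor : forall x y z, lt x y -> lt (add x z) (add y z)
}.

Record dense_no_endpoints (M : Type) (lt : M -> M -> Prop) : Prop := {
  dn_dense : forall x y, lt x y -> exists z, lt x z /\ lt z y;
  dn_nomin : forall x, exists y, lt y x;
  dn_nomax : forall x, exists y, lt x y
}.

(* "Definable in M with parameters".  D n A means: A ⊆ M^n is          *)
(* definable.  A family D is the collection of definable sets (with     *)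
(* parameters) of some expansion of (M,<,+,0) iff it satisfies the      *)
(* closure conditions below (van den Dries' notion of a structure on M, *)
(* containing <, the graph of +, and all singletons = parameters).      *)
Record is_structure (M : Type) (lt : M -> M -> Prop) (add : M -> M -> M)
    (D : forall n, (pt M n -> Prop) -> Prop) : Prop := {
  st_ext : forall n (A B : pt M n -> Prop),
      D n A -> (forall x, A x <-> B x) -> D n B;
  st_full : forall n, D n (fun _ => True);
  st_compl : forall n A, D n A -> D n (fun x => ~ A x);
  st_inter : forall n A B, D n A -> D n B -> D n (fun x => A x /\ B x);
  (* preimages under coordinate maps M^n -> M^m (products, permutations,
     identification of coordinates) *)
  st_reindex : forall m n (f : 'I_m -> 'I_n) A,
      D m A -> D n (fun x => A (fun i => x (f i)));
  st_proj : forall n A, D n.+1 A -> D n (fun x => exists y, A (ext x y));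
  st_eq : D 2 (fun x => x ord0 = x ord_max);
  st_lt : D 2 (fun x => lt (x ord0) (x ord_max));
  st_add : D 3 (fun x => x ord_max = add (x ord0) (x (inord 1)));
  st_const : forall a, D 1 (fun x => x ord0 = a)
}.

Definition locally_o_minimal (M : Type) (lt : M -> M -> Prop)
    (D : forall n, (pt M n -> Prop) -> Prop) : Prop :=
  forall Y : pt M 1 -> Prop, D 1 Y -> forall a : M,
    exists c d, lt c a /\ lt a d /\
      exists (ps : seq M) (ivs : seq (M * M)),
        forall t, lt c t -> lt t d ->
          (Y (pt1 t) <->
             (List.In t ps \/
              exists ab, List.In ab ivs /\ lt ab.1 t /\ lt t ab.2)).

(* definably complete: every definable subset of M has a sup and an inf
   in M ∪ {±oo}; i.e. nonempty definable sets bounded above (below) have a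
   least upper (greatest lower) bound in M. *)
Definition definably_complete (M : Type) (lt : M -> M -> Prop)
    (D : forall n, (pt M n -> Prop) -> Prop) : Prop :=
  forall Y : pt M 1 -> Prop, D 1 Y -> (exists t, Y (pt1 t)) ->
    ((exists b, forall t, Y (pt1 t) -> ~ lt b t) ->
       exists s, (forall t, Y (pt1 t) -> ~ lt s t) /\
                 (forall b, (forall t, Y (pt1 t) -> ~ lt b t) -> ~ lt b s)) /\
    ((exists b, forall t, Y (pt1 t) -> ~ lt t b) ->
       exists s, (forall t, Y (pt1 t) -> ~ lt t s) /\
                 (forall b, (forall t, Y (pt1 t) -> ~ lt t b) -> ~ lt s b)).

(* Definable topological spaces: a definable X ⊆ M^n with a topology    *)
(* generated by the definable open base {bset u : bidx u}, u ∈ M^pdim.  *)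
Record dtop (M : Type) := DTop {
  dim : nat;
  carrier : pt M dim -> Prop;
  pdim : nat;
  bidx : pt M pdim -> Prop;
  bset : pt M pdim -> pt M dim -> Prop
}.
Arguments dim {M} d.
Arguments carrier {M} d _.
Arguments pdim {M} d.
Arguments bidx {M} d _.
Arguments bset {M} d _ _.

Section Topology.
Variables (M : Type) (D : forall n, (pt M n -> Prop) -> Prop) (T : dtop M).
Local Notation P := (pt M (dim T)).

Definition is_base : Prop :=
  (forall u y, bidx T u -> bset T u y -> carrier T y) /\
  (forall x, carrier T x -> exists u, bidx T u /\ bset T u x) /\
  (forall u v x, bidx T u -> bidx T v -> bset T u x -> bset T v x ->
     exists w, bidx T w /\ bset T w x /\
       forall y, bset T w y -> bset T u y /\ bset T v y).

Definition is_dts : Prop :=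
  D (carrier T) /\ D (bidx T) /\
  D (fun z : pt M (pdim T + dim T) => bidx T (lsplit z) /\ bset T (lsplit z) (rsplit z)) /\
  is_base.

Definition nbhd (x : P) (N : P -> Prop) : Prop :=
  exists u, bidx T u /\ bset T u x /\ forall y, bset T u y -> N y.

Definition closure (S : P -> Prop) (y : P) : Prop :=
  carrier T y /\ forall u, bidx T u -> bset T u y -> exists z, bset T u z /\ S z.

Definition closed_in (K F : P -> Prop) : Prop :=
  (forall y, F y -> K y) /\
  forall y, K y -> ~ F y ->
    exists u, bidx T u /\ bset T u y /\ forall z, bset T u z -> K z -> ~ F z.

Definition regular : Prop :=
  forall x u, carrier T x -> bidx T u -> bset T u x ->
    exists v, bidx T v /\ bset T v x /\ forall y, closure (bset T v) y -> bset T u y.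

Definition def_compact (K : P -> Prop) : Prop :=
  forall q (V : pt M q -> Prop) (F : pt M q -> P -> Prop),
    D V ->
    D (fun z : pt M (q + dim T) => V (lsplit z) /\ F (lsplit z) (rsplit z)) ->
    (exists v, V v) ->
    (forall v, V v -> (exists y, F v y) /\ closed_in K (F v)) ->
    (forall v1 v2, V v1 -> V v2 ->
       exists v3, V v3 /\ forall y, F v3 y -> F v1 y /\ F v2 y) ->
    exists y, forall v, V v -> F v y.

Definition locally_def_compact : Prop :=
  forall x, carrier T x ->
    exists K : P -> Prop, D K /\ (forall y, K y -> carrier T y) /\
      nbhd x K /\ def_compact K.

Definition isolated_in (C : P -> Prop) (x : P) : Prop :=
  exists u, bidx T u /\ bset T u x /\ forall y, bset T u y -> C y -> y = x.

End Topology.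
Arguments is_base {M} T.
Arguments is_dts {M} D T.
Arguments nbhd {M} T x N.
Arguments closure {M} T S y.
Arguments closed_in {M} T K F.
Arguments regular {M} T.
Arguments def_compact {M} D T K.
Arguments locally_def_compact {M} D T.
Arguments isolated_in {M} T C x.

Section Curves.
Variables (M : Type) (lt : M -> M -> Prop) (zero : M)
  (D : forall n, (pt M n -> Prop) -> Prop).

Definition def_curve (n : nat) (g : M -> pt M n) : Prop :=
  D (fun z : pt M (1 + n) =>
       lt zero (lsplit z ord0) /\ forall i, rsplit z i = g (lsplit z ord0) i).

Variable T : dtop M.

Definition conv_right (g : M -> pt M (dim T)) (y : pt M (dim T)) : Prop :=
  carrier T y /\
  forall t, lt zero t -> forall A, D A -> nbhd T y A ->
    exists s, lt t s /\ A (g s).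

Definition conv_left (g : M -> pt M (dim T)) (y : pt M (dim T)) : Prop :=
  carrier T y /\
  forall t, lt zero t -> forall A, D A -> nbhd T y A ->
    exists s, lt zero s /\ lt s t /\ A (g s).

End Curves.
Arguments def_curve {M} lt zero D {n} g.
Arguments conv_right {M} lt zero D T g y.
Arguments conv_left {M} lt zero D T g y.

(* Main.v *)
(** Suppose that no definable curve in [C \ {x}] accumulates at [x].  By
    definable choice and definable compactness, [x] is then not isolated in the
    intersection of a definable chain of closed subsets of [C], contained in a
    compact neighbourhood, if it is not isolated in any of them.  The point is
    to reach, by such chains only, the intersection of all closed basic
    neighbourhoods [N_u], [u] in [M^p], which contains only points inseparable
    from [x]; such a point gives a constant curve.

    The parameters are eliminated one coordinate [t] at a time.  Call [t] bad if
    no interval around it has a common neighbourhood.  The neighbourhoods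
    contained in [N_t] give a directed definable family of subsets of the line,
    and a directed definable family, with parameters in [M^m], whose union has
    interior has a member with interior; hence the bad points form a discrete
    set.  The intersection over the [t] with [|t| < r] which are bad or at
    distance at least [e] from the bad points is again a neighbourhood, and it
    is monotone in [r] and [e]: one parameter [t] has been traded for two chain
    parameters.

    The statement on directed families is a dimension count ([m + 1] generic
    points of the line cannot lie in a common member of an [m]-parameter family
    of discrete sets) resting on one fact about the line: a definable total
    relation on an interval has a section with interior. *)

From Stdlib Require Import Classical FunctionalExtensionality IndefiniteDescription.
From mathcomp Require Import all_boot.
Require Import Defs.

Set Implicit Arguments.
Unset Strict Implicit.
Unset Printing Implicit Defensive.

Section Definability.

Variables (M : Type) (lt : M -> M -> Prop) (add : M -> M -> M) (zero : M).
Variable D : forall n, (pt M n -> Prop) -> Prop.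
Hypothesis OG : ordered_group lt add zero.
Hypothesis DN : dense_no_endpoints lt.
Hypothesis ST : is_structure lt add D.
Hypothesis LO : locally_o_minimal lt D.
Hypothesis DC : definably_complete lt D.

(** * Definable predicates and definable terms *)

Definition init n (z : pt M n.+1) : pt M n := fun i => z (lift ord_max i).
Definition last n (z : pt M n.+1) : M := z ord_max.

Lemma init_ext n (x : pt M n) y : init (ext x y) = x.
Proof. by apply: functional_extensionality => i; rewrite /init /ext liftK. Qed.

Lemma last_ext n (x : pt M n) y : last (ext x y) = y.
Proof. by rewrite /last /ext unlift_none. Qed.

Lemma ext_init_last n (z : pt M n.+1) : ext (init z) (last z) = z.
Proof.
apply: functional_extensionality => i; rewrite /ext.
by case: unliftP => [j|] ->.
Qed.

Lemma D_ext n (A B : pt M n -> Prop) :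
  (forall x, A x <-> B x) -> D A -> D B.
Proof. by move=> h hA; apply: (st_ext ST hA). Qed.

Lemma D_const n (P : Prop) : D (fun _ : pt M n => P).
Proof.
have [h|h] := classic P; first by apply: D_ext (st_full ST n).
by apply: D_ext (st_compl ST (st_full ST n)); split.
Qed.

Lemma D_not n (A : pt M n -> Prop) : D A -> D (fun x => ~ A x).
Proof. exact: (st_compl ST). Qed.

Lemma D_and n (A B : pt M n -> Prop) : D A -> D B -> D (fun x => A x /\ B x).
Proof. exact: (st_inter ST). Qed.

Lemma D_or n (A B : pt M n -> Prop) : D A -> D B -> D (fun x => A x \/ B x).
Proof.
move=> hA hB; apply: D_ext (D_not (D_and (D_not hA) (D_not hB))) => x; tauto.
Qed.

Lemma D_imp n (A B : pt M n -> Prop) : D A -> D B -> D (fun x => A x -> B x).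
Proof.
move=> hA hB; apply: D_ext (D_or (D_not hA) hB) => x; tauto.
Qed.

Lemma D_ex n (A : pt M n -> M -> Prop) :
  D (fun z : pt M n.+1 => A (init z) (last z)) -> D (fun x => exists y, A x y).
Proof.
move=> /(st_proj ST); apply: D_ext => x.
by split=> -[y h]; exists y; move: h; rewrite init_ext last_ext.
Qed.

Lemma D_all n (A : pt M n -> M -> Prop) :
  D (fun z : pt M n.+1 => A (init z) (last z)) -> D (fun x => forall y, A x y).
Proof.
move=> h; apply: D_ext (D_not (D_ex (A := fun x y => ~ A x y) (D_not h))) => x.
split=> [h1 y|h1 [y]]; last by apply.
by apply: NNPP => h2; apply: h1; exists y.
Qed.

Lemma D_ord n k (A : 'I_k -> pt M n -> Prop) :
  (forall i, D (A i)) -> D (fun x => forall i, A i x).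
Proof.
elim: k A => [|k IH] A h.
  by apply: D_ext (D_const n True) => x; split=> // _ [].
apply: D_ext (D_and (IH (fun j => A (lift ord_max j)) _) (h ord_max)) => // x.
by split=> [[h1 h2] i|] //; case: (unliftP ord_max i) => [j|] ->.
Qed.

Lemma D_exv n k (A : pt M n -> pt M k -> Prop) :
  D (fun z : pt M (n + k) => A (lsplit z) (rsplit z)) ->
  D (fun x => exists v, A x v).
Proof.
elim: k n A => [|k IH] n A h.
  have e (v w : pt M 0) : v = w by apply: functional_extensionality => -[].
  pose f (i : 'I_(n + 0)) : 'I_n := cast_ord (addn0 n) i.
  apply: D_ext (st_reindex ST f h) => x.
  have -> : lsplit (fun i => x (f i)) = x.
    apply: functional_extensionality => i; rewrite /lsplit /f; congr x.
    exact: val_inj.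
  split=> [h1|[v]]; first by exists (rsplit (fun i => x (f i))).
  by rewrite (e v (rsplit (fun i => x (f i)))).
apply: (@D_ext _ (fun x => exists y, exists v, A x (ext v y))).
  move=> x; split=> [[y [v h1]]|[v h1]]; first by exists (ext v y).
  by exists (last v), (init v); rewrite ext_init_last.
apply: D_ex; apply: IH.
(* [f] sends the last coordinate of the second block to the place just after the first block, where
   the projection for [y] expects it. *)
pose f (i : 'I_(n + k.+1)) : 'I_(n.+1 + k) := match split i with
  | inl j => lshift k (lift ord_max j)
  | inr j => match unlift ord_max j with
    Some j' => rshift n.+1 j' | None => lshift k ord_max end end.
apply: D_ext (st_reindex ST f h) => w.
have -> : lsplit (fun i => w (f i)) = init (lsplit w).
  apply: functional_extensionality => i; rewrite /lsplit /f.
  by rewrite -[lshift _ i]/(unsplit (inl i)) unsplitK.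
suff -> : rsplit (fun i => w (f i)) = ext (rsplit w) (last (lsplit w)) by [].
apply: functional_extensionality => i; rewrite /rsplit /f.
rewrite -[rshift _ i]/(unsplit (inr i)) unsplitK /ext.
by case: unliftP.
Qed.

Lemma D_allv n k (A : pt M n -> pt M k -> Prop) :
  D (fun z : pt M (n + k) => A (lsplit z) (rsplit z)) ->
  D (fun x => forall v, A x v).
Proof.
move=> h; apply: D_ext (D_not (D_exv (A := fun x y => ~ A x y) (D_not h))) => x.
split=> [h1 y|h1 [y]]; last by apply.
by apply: NNPP => h2; apply: h1; exists y.
Qed.

(* [tm t] says that [t], a function of the point of the ambient context
   [pt M n], is a definable term; a predicate [A] is definable ([def1], [def2],
   ...) when substituting definable terms for its arguments always yields a
   definable set. *)
Class sort (T : Type) := tm : forall n, (pt M n -> T) -> Prop.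
Instance sortM : sort M :=
  fun n t => D (fun z : pt M n.+1 => last z = t (init z)).
(* Sealed, so that unification does not unfold vectors into coordinates. *)
Variant tmV n k (v : pt M n -> pt M k) : Prop :=
  TmV of forall i, @tm M sortM n (fun x => v x i).
Instance sortV k : sort (pt M k) := fun n v => @tmV n k v.

Lemma tm_coord n k (v : pt M n -> pt M k) i : tm v -> tm (fun x => v x i).
Proof. by case. Qed.

Definition def1 T {s : sort T} (A : T -> Prop) :=
  forall n (t : pt M n -> T), tm t -> D (fun x => A (t x)).
Definition def2 T1 T2 {s1 : sort T1} {s2 : sort T2} (A : T1 -> T2 -> Prop) :=
  forall n (t1 : pt M n -> T1) (t2 : pt M n -> T2),
    tm t1 -> tm t2 -> D (fun x => A (t1 x) (t2 x)).
Definition def3 T1 T2 T3 {s1 : sort T1} {s2 : sort T2} {s3 : sort T3}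
    (A : T1 -> T2 -> T3 -> Prop) :=
  forall n (t1 : pt M n -> T1) (t2 : pt M n -> T2) (t3 : pt M n -> T3),
    tm t1 -> tm t2 -> tm t3 -> D (fun x => A (t1 x) (t2 x) (t3 x)).
Definition deff T1 T2 {s1 : sort T1} {s2 : sort T2} (f : T1 -> T2) :=
  forall n (t : pt M n -> T1), tm t -> tm (fun x => f (t x)).

Lemma D_eqvar n (i j : 'I_n) : D (fun x : pt M n => x i = x j).
Proof.
exact: (st_reindex ST (fun k : 'I_2 => if k == ord0 then i else j) (st_eq ST)).
Qed.

(** Substitution reduces to projection: [A (v x)] holds iff some [w] in [A] satisfies all equations
    [w i = v x i], and these are the graphs provided by [tm v]. *)
Lemma D_subst n k (A : pt M k -> Prop) (v : pt M n -> pt M k) :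
  D A -> tm v -> D (fun x => A (v x)).
Proof.
move=> hA [hv].
apply: (@D_ext _ (fun x => exists w : pt M k, (forall i, w i = v x i) /\ A w)).
  move=> x; split=> [[w [e]]|h]; last by exists (v x).
  by have -> : w = v x by apply: functional_extensionality.
apply: D_exv; apply: D_and; last by apply: D_ext (st_reindex ST (@rshift n k) hA).
apply: D_ord => i.
pose f (l : 'I_n.+1) : 'I_(n + k) := match unlift ord_max l with
  Some j => lshift k j | None => rshift n i end.
apply: D_ext (st_reindex ST f (hv i)) => z.
rewrite /last /f unlift_none.
suff -> : init (fun i0 => z (f i0)) = lsplit z by rewrite /f.
by apply: functional_extensionality => j; rewrite /init /f liftK.
Qed.

Lemma tm_coord0 n (i : 'I_n) : tm (fun x : pt M n => x i).
Proof. exact: (@D_eqvar n.+1 ord_max (lift ord_max i)). Qed.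

Lemma tm_weaken n (t : pt M n -> M) : tm t -> tm (fun z : pt M n.+1 => t (init z)).
Proof.
move=> h.
pose f (l : 'I_n.+1) : 'I_n.+2 := match unlift ord_max l with
  Some j => lift ord_max (lift ord_max j) | None => ord_max end.
apply: D_ext (st_reindex ST f h) => z.
rewrite /last /f unlift_none.
suff -> : init (fun i0 => z (f i0)) = init (init z) by rewrite /f.
by apply: functional_extensionality => j; rewrite /init /f liftK.
Qed.

Lemma tm_comp n k (t : pt M k -> M) (v : pt M n -> pt M k) :
  tm t -> tm v -> tm (fun x => t (v x)).
Proof.
move=> ht [hv].
apply: (@D_ext _ (fun z : pt M n.+1 => let w := ext (v (init z)) (last z) in
   last w = t (init w))).
  by move=> z /=; rewrite init_ext last_ext.
apply: (D_subst (v := fun z => ext (v (init z)) (last z)) ht); constructor=> i.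
rewrite /ext; case: (unliftP ord_max i) => [j _|_].
  exact: (tm_weaken (hv j)).
exact: (tm_coord0 ord_max).
Qed.

Lemma tm_compv n k l (t : pt M k -> pt M l) (v : pt M n -> pt M k) :
  tm t -> tm v -> tm (fun x => t (v x)).
Proof. by move=> [ht] hv; constructor=> i; apply: tm_comp (ht i) hv. Qed.

Lemma tm_id n : tm (fun x : pt M n => x).
Proof. by constructor=> i; apply: tm_coord0. Qed.

Lemma tm_const n (a : M) : tm (fun _ : pt M n => a).
Proof. exact: (st_reindex ST (fun _ : 'I_1 => ord_max) (st_const ST a)). Qed.

Lemma tm_constv n k (a : pt M k) : tm (fun _ : pt M n => a).
Proof. by constructor=> i; apply: tm_const. Qed.

Lemma tm_init n k (v : pt M n -> pt M k.+1) : tm v -> tm (fun x => init (v x)).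
Proof. by move=> [h]; constructor=> i; apply: h. Qed.

Lemma tm_last n k (v : pt M n -> pt M k.+1) : tm v -> tm (fun x => last (v x)).
Proof. exact: tm_coord. Qed.

Lemma tm_lsplit n k l (v : pt M n -> pt M (k + l)) :
  tm v -> tm (fun x => lsplit (v x)).
Proof. by move=> [h]; constructor=> i; apply: h. Qed.

Lemma tm_rsplit n k l (v : pt M n -> pt M (k + l)) :
  tm v -> tm (fun x => rsplit (v x)).
Proof. by move=> [h]; constructor=> i; apply: h. Qed.

Lemma tm_ext n k (v : pt M n -> pt M k) (t : pt M n -> M) :
  tm v -> tm t -> tm (fun x => ext (v x) (t x)).
Proof.
move=> [hv] ht; constructor=> i; rewrite /ext; case: (unliftP ord_max i) => [j _|_] //.
Qed.

Lemma D_eq n (s t : pt M n -> M) : tm s -> tm t -> D (fun x => s x = t x).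
Proof.
move=> hs ht.
apply: (@D_ext _ (fun x => let w := ext (ext (fun _ : 'I_0 => zero) (s x)) (t x) in
   last (init w) = last w)).
  by move=> x /=; rewrite init_ext !last_ext.
apply: (@D_subst n 2 (fun w => last (init w) = last w)); first exact: D_eqvar.
by apply: tm_ext => //; apply: tm_ext => //; apply: tm_constv.
Qed.

Lemma D_veq n k (s t : pt M n -> pt M k) : tm s -> tm t -> D (fun x => s x = t x).
Proof.
move=> hs ht; apply: (@D_ext _ (fun x => forall i, s x i = t x i)).
  move=> x; split=> [h|->] //; exact: functional_extensionality.
by apply: D_ord => i; apply: D_eq; apply: tm_coord.
Qed.

Lemma D_lt n (s t : pt M n -> M) : tm s -> tm t -> D (fun x => lt (s x) (t x)).
Proof.
move=> hs ht.
pose v x : pt M 2 := ext (ext (fun _ : 'I_0 => zero) (s x)) (t x).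
have hv : tm v by apply: tm_ext => //; apply: tm_ext => //; apply: tm_constv.
apply: D_ext (D_subst (st_lt ST) hv) => x.
have -> : v x ord_max = t x by exact: last_ext.
suff -> : v x ord0 = s x by [].
have -> : v x ord0 = last (init (v x)) by congr (v x); apply: val_inj.
by rewrite init_ext last_ext.
Qed.

Lemma tm_add n (s t : pt M n -> M) : tm s -> tm t -> tm (fun x => add (s x) (t x)).
Proof.
move=> hs ht.
pose v (z : pt M n.+1) : pt M 3 :=
  ext (ext (ext (fun _ : 'I_0 => zero) (s (init z))) (t (init z))) (last z).
have hv : tm v.
  apply: tm_ext; last exact: tm_coord0.
  apply: tm_ext; last exact: tm_weaken.
  by apply: tm_ext; [apply: tm_constv | apply: tm_weaken].
apply: D_ext (D_subst (st_add ST) hv) => x.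
have -> : v x ord_max = last x by exact: last_ext.
have -> : v x ord0 = last (init (init (v x))).
  by congr (v x); apply: val_inj.
have -> : v x (inord 1) = last (init (v x)).
  by congr (v x); apply: val_inj; rewrite /= inordK.
by rewrite !(init_ext, last_ext).
Qed.

Lemma def1P k (A : pt M k -> Prop) : D A -> def1 A.
Proof. by move=> h n t; apply: D_subst. Qed.

Lemma def2P k l (A : pt M k -> pt M l -> Prop) :
  D (fun z : pt M (k + l) => A (lsplit z) (rsplit z)) -> def2 A.
Proof.
move=> h n t1 t2 h1 h2.
pose v x : pt M (k + l) := fun i => match split i with
  inl j => t1 x j | inr j => t2 x j end.
have hv : tm v.
  by constructor=> i; rewrite /v; case: (split i) => j; apply: tm_coord.
apply: D_ext (D_subst h hv) => x.
have -> : lsplit (v x) = t1 x.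
  apply: functional_extensionality => i; rewrite /lsplit /v.
  by rewrite -[lshift _ i]/(unsplit (inl i)) unsplitK.
suff -> : rsplit (v x) = t2 x by [].
apply: functional_extensionality => i; rewrite /rsplit /v.
by rewrite -[rshift _ i]/(unsplit (inr i)) unsplitK.
Qed.

(** Syntax-directed search: connectives and quantifiers are peeled off and atoms are closed by
    hypotheses. Hence facts such as [def2_bs] are put into the context before [dsolve] is called. *)
Ltac dstep :=
  cbv beta;
  lazymatch goal with
  | |- @def1 _ _ _ => intros ? ? ?
  | |- @def2 _ _ _ _ _ => intros ? ? ? ? ?
  | |- @def3 _ _ _ _ _ _ _ => intros ? ? ? ? ? ? ?
  | |- @deff _ _ _ _ _ => intros ? ? ?
  | |- @tm _ _ _ (@init _) => simple apply tm_init
  | |- @tm _ _ _ (@last _) => simple apply tm_last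
  | |- @tm _ _ _ (@lsplit _ _ _) => simple apply tm_lsplit
  | |- @tm _ _ _ (@rsplit _ _ _) => simple apply tm_rsplit
  | |- @tm _ _ _ (fun x => init _) => simple apply tm_init
  | |- @tm _ _ _ (fun x => last _) => simple apply tm_last
  | |- @tm _ _ _ (fun x => lsplit _) => simple apply tm_lsplit
  | |- @tm _ _ _ (fun x => rsplit _) => simple apply tm_rsplit
  | |- @tm _ _ _ (fun x => ext _ _) => simple apply tm_ext
  | |- @tm _ _ _ (fun x => x) => simple apply tm_id
  | |- @tm _ (@sortV _) _ _ => first
    [ assumption | simple apply tm_constv
    | match goal with H : _ |- _ => simple apply H end
    | match goal with H : @tm _ (@sortV _) _ _ |- _ => refine (tm_compv H _) end ]
  | |- @tm _ sortM _ _ => first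
    [ assumption | simple apply tm_const | simple apply tm_add
    | match goal with H : _ |- _ => simple apply H end
    | match goal with H : @tm _ sortM _ _ |- _ => refine (tm_comp H _) end
    | match goal with |- @tm _ _ _ (fun x => _ ?i) =>
        refine (@tm_coord _ _ _ i _) end ]
  | |- D _ => first
    [ assumption
    | simple apply D_const
    | simple apply D_and | simple apply D_or | simple apply D_not
    | simple apply D_ex | simple apply D_exv
    | simple apply D_all | simple apply D_allv | simple apply D_imp
    | simple apply D_eq | simple apply D_veq | simple apply D_lt
    | match goal with H : _ |- _ => simple apply H end ]
  end.
Ltac dsolve := solve [repeat dstep].

(** * Order and group *)

Definition opp (x : M) : M :=
  proj1_sig (constructive_indefinite_description _ (og_inv OG x)).

Lemma addNr x : add x (opp x) = zero.
Proof. by rewrite /opp; case: constructive_indefinite_description => y /= []. Qed.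

Lemma addNl x : add (opp x) x = zero.
Proof. by rewrite /opp; case: constructive_indefinite_description => y /= []. Qed.

Lemma addKl a b : add (opp a) (add a b) = b.
Proof. by rewrite (og_assoc OG) addNl (og_zerol OG). Qed.

Lemma addNKl a b : add a (add (opp a) b) = b.
Proof. by rewrite (og_assoc OG) addNr (og_zerol OG). Qed.

Lemma addNKr a b : add (add b (opp a)) a = b.
Proof. by rewrite -(og_assoc OG) addNl (og_zeror OG). Qed.

Lemma oppK x : opp (opp x) = x.
Proof. by rewrite -[RHS](og_zerol OG) -(addNl (opp x)) -(og_assoc OG) addNl (og_zeror OG). Qed.

Lemma lt_addl z x y : lt x y -> lt (add z x) (add z y).
Proof. exact: (og_monol OG). Qed.

Lemma lt_addr z x y : lt x y -> lt (add x z) (add y z).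
Proof. exact: (og_monor OG). Qed.

Lemma lt_opp x y : lt x y -> lt (opp y) (opp x).
Proof.
move=> /(lt_addl (opp x)) /(lt_addr (opp y)).
by rewrite addNl (og_zerol OG) -(og_assoc OG) addNr (og_zeror OG).
Qed.

Lemma lt_addpos x e : lt zero e -> lt x (add x e).
Proof. by move=> /(lt_addl x); rewrite (og_zeror OG). Qed.

(** [opp] comes from an abstract choice of inverses; its graph is recovered from the equation it
    solves. *)
Lemma tm_opp n (t : pt M n -> M) : tm t -> tm (fun x => opp (t x)).
Proof.
move=> ht; apply: (@D_ext _ (fun z => add (t (init z)) (last z) = zero)); last by dsolve.
move=> z; split=> [h|->]; last exact: addNr.
by rewrite -(addKl (t (init z)) (last z)) h (og_zeror OG).
Qed.

Lemma le_lt_trans a b c : ~ lt b a -> lt b c -> lt a c.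
Proof.
move=> h1 h2; have [h|[->|h]] := og_total OG a b => //.
exact: og_trans OG _ _ _ h h2.
Qed.

Lemma lt_le_trans a b c : lt a b -> ~ lt c b -> lt a c.
Proof.
move=> h1 h2; have [h|[<-|h]] := og_total OG b c => //.
exact: og_trans OG _ _ _ h1 h.
Qed.

Lemma le_trans a b c : ~ lt b a -> ~ lt c b -> ~ lt c a.
Proof. by move=> h1 h2 h3; apply: h2; apply: lt_le_trans h3 h1. Qed.

Lemma le_anti a b : ~ lt a b -> ~ lt b a -> a = b.
Proof. by case: (og_total OG a b) => [|[]]. Qed.

Lemma lt_lt_false a b : lt a b -> lt b a -> False.
Proof. by move=> h1 h2; apply: (og_irrefl OG (x := a)); apply: og_trans OG _ _ _ h1 h2. Qed.

(** [~ lt b a] plays the part of [a <= b]. [ord] saturates hypotheses of both forms under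
    transitivity until two of them clash. *)
Ltac know P := match goal with H : P |- _ => idtac end.
Ltac ord_close :=
  match goal with
  | H : lt ?a ?a |- _ => exact (og_irrefl OG H)
  | H : ?P, H' : ~ ?P |- _ => exact (H' H)
  | H : lt ?a ?b, H' : lt ?b ?a |- _ => exact (lt_lt_false H H')
  | H : ?a <> ?a |- _ => exact (H erefl)
  end.
Ltac ord_sat :=
  repeat first [ ord_close | match goal with
  | H1 : lt ?a ?b, H2 : lt ?b ?c |- _ =>
      tryif know (lt a c) then fail else pose proof (og_trans OG H1 H2)
  | H1 : lt ?a ?b, H2 : ~ lt ?c ?b |- _ =>
      tryif know (lt a c) then fail else pose proof (lt_le_trans H1 H2)
  | H1 : ~ lt ?b ?a, H2 : lt ?b ?c |- _ =>
      tryif know (lt a c) then fail else pose proof (le_lt_trans H1 H2)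
  | H1 : ~ lt ?b ?a, H2 : ~ lt ?c ?b |- _ =>
      tryif know (~ lt c a) then fail else pose proof (le_trans H1 H2)
  end ].
Ltac ord :=
  intros; subst;
  repeat match goal with H : _ /\ _ |- _ => destruct H | |- _ /\ _ => split end;
  first [ assumption |
  match goal with
  | |- False => idtac
  | |- ~ (_ /\ _) => intros []
  | |- ~ lt _ _ => intro
  | |- _ <> _ => intro; subst
  | |- lt _ _ => apply: NNPP; intro
  | |- _ = _ => apply: le_anti; intro
  end; solve [ord_sat] ].

Lemma dense a b : lt a b -> exists c, lt a c /\ lt c b.
Proof. exact: (dn_dense DN). Qed.

Lemma min_above a b c : lt a b -> lt a c -> exists m, lt a m /\ ~ lt b m /\ ~ lt c m.
Proof.
move=> h1 h2; have [h|h] := classic (lt b c); first by exists b; ord.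
by exists c; ord.
Qed.

Lemma max_below a b c : lt b a -> lt c a -> exists m, lt m a /\ ~ lt m b /\ ~ lt m c.
Proof.
move=> h1 h2; have [h|h] := classic (lt b c); first by exists c; ord.
by exists b; ord.
Qed.

Lemma def1_pt1 (S : M -> Prop) : def1 S -> D (fun z : pt M 1 => S (z ord0)).
Proof. by move=> h; apply: h; apply: tm_coord0. Qed.

Lemma sup_ex (S : M -> Prop) b : def1 S -> (exists t, S t) ->
  (forall t, S t -> ~ lt b t) ->
  exists s, (forall t, S t -> ~ lt s t) /\ (forall t, lt t s -> exists t', S t' /\ lt t t').
Proof.
move=> hS h1 h2; have [h _] := DC (def1_pt1 hS) h1.
have [s [ub lub]] := h (ex_intro _ b h2); exists s; split=> // t hts.
apply: NNPP => h3; apply: (lub t) hts => t' ht' htt'; apply: h3.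
by exists t'.
Qed.

Lemma inf_ex (S : M -> Prop) b : def1 S -> (exists t, S t) ->
  (forall t, S t -> ~ lt t b) ->
  exists s, (forall t, S t -> ~ lt t s) /\ (forall t, lt s t -> exists t', S t' /\ lt t' t).
Proof.
move=> hS h1 h2; have [_ h] := DC (def1_pt1 hS) h1.
have [s [ub lub]] := h (ex_intro _ b h2); exists s; split=> // t hts.
apply: NNPP => h3; apply: (lub t) hts => t' ht' htt'; apply: h3.
by exists t'.
Qed.

(** * Germs and interiors of definable subsets of the line *)

Definition rgerm (a : M) (S : M -> Prop) :=
  exists b, lt a b /\ forall t, lt a t -> lt t b -> S t.
Definition lgerm (a : M) (S : M -> Prop) :=
  exists b, lt b a /\ forall t, lt b t -> lt t a -> S t.
Definition hasint (S : M -> Prop) :=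
  exists a b, lt a b /\ forall t, lt a t -> lt t b -> S t.

Lemma rgerm_mono a (S S' : M -> Prop) : (forall t, S t -> S' t) -> rgerm a S -> rgerm a S'.
Proof. by move=> h [b [h1 h2]]; exists b; split=> // t ? ?; apply: h; apply: h2. Qed.

Lemma rgerm_and a (S S' : M -> Prop) :
  rgerm a S -> rgerm a S' -> rgerm a (fun t => S t /\ S' t).
Proof.
move=> [b [h1 h2]] [b' [h1' h2']]; have [m [hm [hm1 hm2]]] := min_above h1 h1'.
by exists m; split=> // t ha ht; split; [apply: h2|apply: h2']; ord.
Qed.

Lemma rgerm_ex a (S : M -> Prop) : rgerm a S -> exists t, lt a t /\ S t.
Proof. by move=> [b [/dense [t [h1 h2]] h]]; exists t; split=> //; apply: h. Qed.

Lemma rgerm_hasint a (S : M -> Prop) : rgerm a S -> hasint S.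
Proof. by move=> [b h]; exists a, b. Qed.

Lemma hasint_mono (S S' : M -> Prop) : (forall t, S t -> S' t) -> hasint S -> hasint S'.
Proof. by move=> h [a [b [h1 h2]]]; exists a, b; split=> // t ? ?; apply: h; apply: h2. Qed.

(** Close to [a] on the right the finitely many points disappear, and each of the finitely many
    intervals either contains or misses a whole germ. *)
Lemma rgerm_dich (S : M -> Prop) a : def1 S -> rgerm a S \/ rgerm a (fun t => ~ S t).
Proof.
move=> hS; have [c [d [hc [hd [ps [ivs h]]]]]] := LO (def1_pt1 hS) a.
have [b1 [hb1 h1]] : rgerm a (fun t => ~ List.In t ps).
  elim: ps {h} => [|p ps IH]; first by exists d; split=> // t _ _ [].
  suff h : rgerm a (fun t => p <> t).
    by apply: rgerm_mono (rgerm_and h IH) => t /= [? ?] [].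
  have [hp|hp] := classic (lt a p); first by exists p; split=> // t; ord.
  by exists d; split=> // t; ord.
pose Q t := exists ab, List.In ab ivs /\ lt ab.1 t /\ lt t ab.2.
have h2 : rgerm a Q \/ rgerm a (fun t => ~ Q t).
  rewrite /Q; elim: ivs {h Q} => [|[p q] ivs IH].
    by right; exists d; split=> // t _ _ [ab []].
  have [|h'] := classic (rgerm a (fun t => lt p t /\ lt t q)).
    move=> h'; left; apply: rgerm_mono h' => t ht; exists (p, q); split=> //; by left.
  case: IH => [IH|IH].
    by left; apply: rgerm_mono IH => t [ab [? ?]]; exists ab; split=> //; right.
  right; suff h2 : rgerm a (fun t => ~ (lt p t /\ lt t q)).
    apply: rgerm_mono (rgerm_and IH h2) => t [h3 h4] [ab [[e|h5] h6]].
      by apply: h4; rewrite -e in h6.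
    by apply: h3; exists ab.
  have [hp|hp] := classic (lt a p); first by exists p; split=> // t; ord.
  have [hq|hq] := classic (lt a q).
    by case: h'; exists q; split=> // t; ord.
  by exists d; split=> // t; ord.
have hcd : rgerm a (fun t => S t <-> List.In t ps \/ Q t).
  by exists d; split=> // t h3 h4; apply: h => //; ord.
have hps : rgerm a (fun t => ~ List.In t ps) by exists b1.
case: h2 => h2; [left|right];
  by apply: rgerm_mono (rgerm_and hcd (rgerm_and hps h2)) => t [h3 [h4 h5]]; tauto.
Qed.

(** The reflection [opp] turns left germs into right germs. *)
Lemma lgerm_dich (S : M -> Prop) a : def1 S -> lgerm a S \/ lgerm a (fun t => ~ S t).
Proof.
move=> hS; have hopp := tm_opp.
have aux (S' : M -> Prop) : rgerm (opp a) (fun t => S' (opp t)) -> lgerm a S'.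
  move=> [b [h1 h2]]; exists (opp b); split.
    by move: (lt_opp h1); rewrite oppK.
  move=> t h3 h4; rewrite -(oppK t); apply: h2; first exact: lt_opp.
  by move: (lt_opp h3); rewrite oppK.
have h : def1 (fun t => S (opp t)) by dsolve.
case: (rgerm_dich (opp a) h) => h'; first by left; apply: aux.
by right; apply: (aux (fun t => ~ S t)).
Qed.

Lemma noint_isolated (S : M -> Prop) a : def1 S -> ~ hasint S ->
  exists l r, lt l a /\ lt a r /\ forall t, lt l t -> lt t r -> S t -> t = a.
Proof.
move=> hS hn.
have [/rgerm_hasint //|[r [hr1 hr2]]] := rgerm_dich a hS.
have [[b [h1 h2]]|[l [hl1 hl2]]] := lgerm_dich a hS; first by case: hn; exists b, a.
exists l, r; split=> //; split=> // t h1 h2 h3.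
have [h|[//|h]] := og_total OG t a; first by case: (hl2 t).
by case: (hr2 t).
Qed.

Lemma hasint_or (S S' : M -> Prop) : def1 S ->
  hasint (fun t => S t \/ S' t) -> hasint S \/ hasint S'.
Proof.
move=> hS [a [b [hab h]]].
have [/rgerm_hasint|h1] := rgerm_dich a hS; first by left.
right; apply: (@rgerm_hasint a).
have h2 : rgerm a (fun t => S t \/ S' t) by exists b.
by apply: rgerm_mono (rgerm_and h1 h2) => t; tauto.
Qed.

(* The one-sided limit at [a] of a multivalued function with values in [c, d]. *)
Lemma cluster (W : M -> M -> Prop) a c d : def2 W ->
  rgerm a (fun e => exists s, ~ lt s c /\ ~ lt d s /\ W e s) ->
  exists y, forall l r, lt l y -> lt y r ->
    rgerm a (fun e => exists s, lt l s /\ lt s r /\ W e s).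
Proof.
move=> hW h0.
(* The limit is the infimum of the heights [y] such that [W e] meets [[c, y]] for all [e] just above
   [a]; for [l] below it, the germ dichotomy makes [W e] miss [[c, l]]. *)
pose Hit y := rgerm a (fun e => exists s, ~ lt s c /\ ~ lt y s /\ W e s).
pose S y := ~ lt y c /\ ~ lt d y /\ Hit y.
have hS : def1 S by rewrite /S /Hit /rgerm; dsolve.
have [||y [h1 h2]] := inf_ex (b := c) hS.
- exists d; have [e [_ [s [hs1 [hs2 _]]]]] := rgerm_ex h0.
  by split; [ord | split=> //; ord].
- by move=> t [].
exists y => l r hl hr; have [y' [[hy1 [hy2 hy3]] hy']] := h2 _ hr.
have hly : rgerm a (fun e => ~ exists s, ~ lt s c /\ ~ lt l s /\ W e s).
  have hd : def1 (fun e => exists s, ~ lt s c /\ ~ lt l s /\ W e s) by dsolve.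
  case: (rgerm_dich a hd) => // hh.
  have [e [_ [s [hs1 [hs2 _]]]]] := rgerm_ex hh.
  case: (h1 l) => //; split; first by ord.
  by split=> // hdl; apply: (h1 y') => //; ord.
apply: rgerm_mono (rgerm_and hly hy3) => e [hn [s [hs1 [hs2 hs3]]]].
exists s; split; last by split=> //; ord.
by apply: NNPP => hs; apply: hn; exists s.
Qed.

(** * Relations on the line: sections, chains, fibres and images with interior *)

Lemma small_shift l s r : lt l s -> lt s r ->
  exists e, lt zero e /\ ~ lt s (add l e) /\ ~ lt r (add s e).
Proof.
move=> h1 h2.
have e1 : lt zero (add (opp l) s) by rewrite -(addNl l); apply: lt_addl.
have e2 : lt zero (add (opp s) r) by rewrite -(addNl s); apply: lt_addl.
have [e [he [he1 he2]]] := min_above e1 e2; exists e; split=> //; split=> h.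
  by apply: he1; move: (lt_addl (opp l) h); rewrite addKl.
by apply: he2; move: (lt_addl (opp s) h); rewrite addKl.
Qed.

(** Distance less than [e], in a form that avoids both absolute values and commutativity. *)
Definition near s s' e := lt s (add s' e) /\ lt s' (add s e).

Lemma near_mono s s' e e' : ~ lt e' e -> near s s' e -> near s s' e'.
Proof.
move=> h; suff aux u : ~ lt (add u e') (add u e).
  by have := aux s; have := aux s'; rewrite /near; ord.
by move=> /(lt_addl (opp u)); rewrite !addKl.
Qed.

Lemma near_small l s r : lt l s -> lt s r ->
  exists e, lt zero e /\ forall s', near s s' e -> lt l s' /\ lt s' r.
Proof.
move=> h1 h2; have [e [he [e1 e2]]] := small_shift h1 h2.
exists e; split=> // s' [n1 n2]; split; last by ord.
apply: NNPP => h; have [hh|[hh|//]] := og_total OG s' l.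
  by have := lt_addr e hh; ord.
by subst; ord.
Qed.

(* A point is [e]-dominant if no other point within distance [e] precedes it.
   The [e]-dominant points form a discrete set, by totality; were all sections
   of [le] discrete, each point would be [e]-dominant for small [e].  The exact
   dominance radii then fill a right neighbourhood of 0, which is impossible,
   since an interval does not map injectively to a bounded discrete set. *)
Lemma total_section_hasint (le : M -> M -> Prop) c0 d0 : def2 le -> lt c0 d0 ->
  (forall s s', le s s' \/ le s' s) ->
  exists s, lt c0 s /\ lt s d0 /\ hasint (fun s' => le s' s).
Proof.
move=> hle hcd0 tot; apply: NNPP => hno.
have [c [hc0 hc]] := dense hcd0; have [d [hcd hd]] := dense hc.
pose E e s := ~ lt s c /\ ~ lt d s /\ forall s', s' <> s -> le s' s -> ~ near s s' e.
have hE : def2 E by rewrite /E /near; dsolve.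
have Emono e e' s : ~ lt e e' -> E e s -> E e' s.
  move=> h [h1 [h2 h3]]; split=> //; split=> // s' h4 h5 h6.
  by apply: (h3 s') => //; apply: near_mono h6.
have Enoint e : lt zero e -> ~ hasint (E e).
  move=> he [p [q [hpq h]]]; have [s [hs1 hs2]] := dense hpq.
  have [m [m1 [m2 m3]]] := min_above hs2 (lt_addpos s he).
  have [s' [hs'1 hs'2]] := dense m1.
  have Hs : E e s by apply: h.
  have Hs' : E e s' by apply: h; ord.
  have hs'e := lt_addpos s' he.
  have n1 : near s s' e by split; ord.
  have n2 : near s' s e by split; ord.
  case: Hs => _ [_ Hs]; case: Hs' => _ [_ Hs'].
  case: (tot s s') => hl; first by apply: (Hs' s) => //; ord.
  by apply: (Hs s') => //; ord.
have Ecov s : ~ lt s c -> ~ lt d s -> exists e, lt zero e /\ E e s.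
  move=> h1 h2.
  have hd1 : def1 (fun s' => le s' s) by dsolve.
  have hn : ~ hasint (fun s' => le s' s) by move=> h; apply: hno; exists s; split; [ord|split=> //; ord].
  have [l [r [hl [hr hlr]]]] := noint_isolated s hd1 hn.
  have [e [he hen]] := near_small hl hr; exists e; split=> //.
  by split=> //; split=> // s' h3 h4 /hen [h5 h6]; apply: h3; apply: hlr.
(* [V s e] makes [e] the exact dominance radius of [s]. By the germ dichotomy at 0, either no small
   [e] is an exact radius or every small [e] is one. *)
pose V s e := lt zero e /\ (forall e', lt zero e' -> lt e' e -> E e' s) /\
              (forall e', lt e e' -> ~ E e' s).
have hV : def2 V by rewrite /V; dsolve.
have hA : def1 (fun e => exists s, ~ lt s c /\ ~ lt d s /\ V s e) by dsolve.
case: (rgerm_dich zero hA) => [[b [hb h]]|[b [hb h]]]; last first.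
  (* No small exact radius: a point that is not [e1]-dominant would have its exact radius in
     [(0, e1]], so all of [(c, d)] is [e1]-dominant. *)
  have [e1 [he1 he1b]] := dense hb.
  apply: (Enoint e1 he1); exists c, d; split=> // s hcs hsd; apply: NNPP => hEs.
  have [||e2 [he2 hEe2]] := Ecov s; try by ord.
  have hS : def1 (fun e => lt zero e /\ E e s) by dsolve.
  have [||e [ub lub]] := sup_ex (b := e1) hS; first by exists e2.
    by move=> t [ht1 ht2] ht3; apply: hEs; apply: Emono ht2; ord.
  have he2e := ub e2 (conj he2 hEe2).
  have hee1 : ~ lt e1 e by move=> /lub [t [[? ht] ?]]; apply: hEs; apply: Emono ht; ord.
  apply: (h e); [ord|ord|exists s; split; [ord|split; [ord|]]].
  split; [ord|split=> [e' h1 /lub [t [[_ ht] htt]]|e' h1 h2]].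
    by apply: Emono ht; ord.
  by apply: (ub e') => //; split=> //; ord.
(* Every small radius occurs. The limit is taken at [e0 > 0], because points of radius above [e0]
   lie in the discrete set [E e0]; close to the limit [y] only [y] itself can be such a point, so
   [y] gets several exact radii. *)
have [e0 [he0 he0b]] := dense hb.
have hW : def2 (fun e s => V s e) by dsolve.
have [|y hy] := cluster (W := fun e s => V s e) (a := e0) (c := c) (d := d) hW.
  by exists b; split=> // t h1 h2; apply: h => //; ord.
have hEe0 : def1 (E e0) by dsolve.
have [l [r [hl [hr hlr]]]] := noint_isolated y hEe0 (Enoint e0 he0).
have [b' [hb' hyb]] := hy l r hl hr.
have Vy e : lt e0 e -> lt e b' -> V y e.
  move=> h1 h2; have [s [hs1 [hs2 hs3]]] := hyb e h1 h2.
  suff <- : s = y by [].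
  by apply: hlr => //; case: hs3 => _ [h3 _]; apply: h3.
have [e1 [h1 h2]] := dense hb'; have [e2 [h3 h4]] := dense h2.
have [e' [h5 h6]] := dense h3.
have [_ [_ V1]] := Vy e1 h1 h2.
have [|_ [V2 _]] := Vy e2 _ h4; first by ord.
by apply: (V1 e') => //; apply: V2 => //; ord.
Qed.

(** Let [s'] be below [s] when every member through [s] contains [s']. For a chain this relation is
    total, and its section at [s] lies in each member through [s]. *)
Lemma chain_hasint (P : M -> Prop) (S : M -> M -> Prop) : def1 P -> def2 S ->
  (forall t t', (forall s, S t s -> S t' s) \/ (forall s, S t' s -> S t s)) ->
  hasint (fun s => exists t, P t /\ S t s) -> exists t, P t /\ hasint (S t).
Proof.
move=> hP hS hch [c [d [hcd hcov]]].
have hle : def2 (fun s' s => forall t, P t -> S t s -> S t s') by dsolve.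
have [|s [hs1 [hs2 hs]]] := total_section_hasint hle hcd.
  move=> s s'; apply: NNPP => /not_or_and [].
  move=> /not_all_ex_not [t /not_all_ex_not [Pt /not_all_ex_not [h1 h2]]].
  move=> /not_all_ex_not [t' /not_all_ex_not [Pt' /not_all_ex_not [h1' h2']]].
  by case: (hch t t') => h; [apply: h2'|apply: h2]; apply: h.
have [t [Pt St]] := hcov s hs1 hs2; exists t; split=> //.
by apply: hasint_mono hs => s'; apply.
Qed.

(** Restricting the witnesses to [(-r, r)] gives a chain in [r] that exhausts [I]. *)
Lemma bounded_hasint (I : M -> Prop) (Q : M -> M -> Prop) : def1 I -> def2 Q ->
  hasint I -> (forall s, I s -> exists t, Q s t) ->
  exists c d, hasint (fun s => I s /\ exists t, ~ lt t c /\ ~ lt d t /\ Q s t).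
Proof.
move=> hI hQ [a [b [hab hIab]]] hex.
(* [lt zero (add t r)] stands for [-r < t] *)
pose S r s := I s /\ exists t, lt zero (add t r) /\ lt t r /\ Q s t.
have hS : def2 S by rewrite /S; dsolve.
have hT : def1 (fun _ : M => True) by dsolve.
have Smono r r' s : ~ lt r' r -> S r s -> S r' s.
  move=> h [Is [t [h1 [h2 h3]]]]; split=> //; exists t.
  split; last by split=> //; ord.
  have hh : ~ lt (add t r') (add t r).
    by move=> /(lt_addl (opp t)); rewrite !addKl.
  by ord.
have [|| r [_ hr]] := chain_hasint hT hS.
- move=> r r'; have [h|h] := classic (lt r' r); [right|left] => s; apply: Smono; ord.
- exists a, b; split=> // s h1 h2; have Is := hIab s h1 h2; have [t ht] := hex s Is.
  have [r0 hr0] := dn_nomax DN t; have [r1 hr1] := dn_nomax DN (opp t).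
  have [r [h3 h4]] : exists r, ~ lt r r0 /\ ~ lt r r1.
    by have [h|h] := classic (lt r0 r1); [exists r1|exists r0]; split=> //; ord.
  exists r; split=> //; split=> //; exists t.
  split; last by split=> //; ord.
  by rewrite -(addNr t); apply: lt_addl; ord.
exists (opp r), r; apply: hasint_mono hr => s [Is [t [h1 [h2 h3]]]]; split=> //.
exists t; split; last by split=> //; ord.
by move=> /(lt_addr r); rewrite addNl; ord.
Qed.

(** If the image is discrete, a one-sided limit [y] of bounded values is isolated in it. Values
    close to [y] then equal [y], and the fibre over [y] has interior. *)
Lemma hasint_fiber_or_image (I : M -> Prop) (Q : M -> M -> Prop) : def1 I -> def2 Q ->
  hasint I -> (forall s, I s -> exists t, Q s t) ->
  (exists t, hasint (fun s => Q s t)) \/ hasint (fun t => exists s, I s /\ Q s t).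
Proof.
move=> hI hQ hI' hex; apply: NNPP => /not_or_and [h1 h2].
have [c [d [a [b [hab hcd]]]]] := bounded_hasint hI hQ hI' hex.
have [||y hy] := cluster (W := fun s t => I s /\ Q s t) (a := a) (c := c) (d := d).
- by dsolve.
- exists b; split=> // s h3 h4; have [Is [t [h5 [h6 h7]]]] := hcd s h3 h4.
  by exists t.
have hd : def1 (fun t => exists s, I s /\ Q s t) by dsolve.
have [l [r [hl [hr hlr]]]] := noint_isolated y hd h2.
apply: h1; exists y; apply: (@rgerm_hasint a); apply: rgerm_mono (hy l r hl hr).
move=> s [t [h3 [h4 [Is Qst]]]]; suff <- : t = y by [].
by apply: hlr => //; exists s.
Qed.

(** A Fubini principle for interiors: a chain argument gives the intervals in many sections a common
    length [e], and their left ends [al], once bounded, have a one-sided limit [y]. *)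
Lemma hasint_swap (I : M -> Prop) (Q : M -> M -> Prop) : def1 I -> def2 Q ->
  hasint I -> (forall s, I s -> hasint (Q s)) ->
  hasint (fun t => hasint (fun s => Q s t)).
Proof.
move=> hI hQ hI' hex.
pose S e s := I s /\ exists al, forall t, lt al t -> lt t (add al e) -> Q s t.
have hS : def2 S by rewrite /S; dsolve.
have hP : def1 (fun e => lt zero e) by dsolve.
have Smono e e' s : ~ lt e e' -> S e s -> S e' s.
  move=> h [Is [al h1]]; split=> //; exists al => t h2 h3; apply: h1 => //.
  have hh : ~ lt (add al e) (add al e').
    by move=> /(lt_addl (opp al)); rewrite !addKl.
  by ord.
have [||e [he heS]] := chain_hasint hP hS.
- move=> e e'; have [h|h] := classic (lt e e'); [right|left] => s; apply: Smono; ord.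
- apply: hasint_mono hI' => s Is; have [p [q [hpq h]]] := hex s Is.
  exists (add (opp p) q); split; first by rewrite -(addNl p); apply: lt_addl.
  by split=> //; exists p => t; rewrite addNKl; apply: h.
pose W s al := forall t, lt al t -> lt t (add al e) -> Q s t.
have hW : def2 W by rewrite /W; dsolve.
have hI1 : def1 (S e) by dsolve.
have [|c [d [a [b [hab hcd]]]]] := bounded_hasint hI1 hW heS; first by move=> s [].
have [|y hy] := cluster (a := a) (c := c) (d := d) hW.
  by exists b; split=> // s h3 h4; case: (hcd s h3 h4).
(* With [y < v1 < v2 < y + e], every [al] between [v2 - e] and [v1] has [(v1, v2)] inside
   [(al, al + e)]. *)
have [v1 [h1 h1']] := dense (lt_addpos y he); have [v2 [h2 h3]] := dense h1'.
have h4 : lt (add v2 (opp e)) y.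
  by move: (lt_addr (opp e) h3); rewrite -(og_assoc OG) addNr (og_zeror OG).
exists v1, v2; split=> // t ht1 ht2; apply: (@rgerm_hasint a).
apply: rgerm_mono (hy _ _ h4 h1) => s [al [h5 [h6 h7]]]; apply: h7; first by ord.
by have := lt_addr e h5; rewrite addNKr; ord.
Qed.
(** * Directed families of subsets of the line *)

(* [fat k R W]: for generically many [s1], generically many [s2], ..., some
   [u] in [W] satisfies [R u s1], ..., [R u sk]. *)
Fixpoint fat k m (R : pt M m -> M -> Prop) (W : pt M m -> Prop) : Prop :=
  match k with
  | 0 => exists u, W u
  | k'.+1 => hasint (fun s => fat k' R (fun u => W u /\ R u s))
  end.

Lemma D_fat k m n (R : pt M n -> pt M m -> M -> Prop) (W : pt M n -> pt M m -> Prop) :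
  def3 R -> def2 W -> D (fun x => fat k (R x) (W x)).
Proof.
elim: k n R W => [|k IH] n R W hR hW; rewrite /fat -/fat; first by dsolve.
by rewrite /hasint; repeat dstep; apply: IH; dsolve.
Qed.

Lemma fat_mono k m (R : pt M m -> M -> Prop) (W W' : pt M m -> Prop) :
  (forall u, W u -> W' u) -> fat k R W -> fat k R W'.
Proof.
elim: k W W' => [|k IH] W W' h /=; first by move=> [u /h]; exists u.
by apply: hasint_mono => s; apply: IH => u [/h].
Qed.

Lemma hasint_ex (S : M -> Prop) : hasint S -> exists t, S t.
Proof. by move=> [a [b [/dense [t [h1 h2]] h]]]; exists t; apply: h. Qed.

Lemma fat_pred k m (R : pt M m -> M -> Prop) (W : pt M m -> Prop) :
  fat k.+1 R W -> fat k R W.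
Proof. by move=> /hasint_ex [s]; apply: fat_mono => u []. Qed.

(** The dimension count: one parameter coordinate absorbs at most one generic point. In the
    induction, each generic [s] falls under one of the two cases; the first is propagated by the
    fibre-or-image alternative, the second by exchanging [s] and [t]. *)
Lemma fat_slice k m (R : pt M m.+1 -> M -> Prop) (W : pt M m.+1 -> Prop) :
  def2 R -> def1 W -> fat k.+1 R W ->
  (exists t, fat k.+1 (fun w => R (ext w t)) (fun w => W (ext w t))) \/
  hasint (fun t => fat k (fun w => R (ext w t)) (fun w => W (ext w t))).
Proof.
move=> hR; elim: k W => [|k IH] W hW hfat.
  pose Q s t := exists w, W (ext w t) /\ R (ext w t) s.
  have hQ : def2 Q by rewrite /Q; dsolve.
  have hI : def1 (fun s => fat 0 R (fun u => W u /\ R u s)) by rewrite /fat; dsolve.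
  have [|[t ht]|h] := hasint_fiber_or_image hI hQ hfat.
  - by move=> s [u [h1 h2]]; exists (last u), (init u); rewrite ext_init_last.
  - by left; exists t.
  by right; apply: hasint_mono h => t [s [_ [w [hw _]]]]; exists w.
pose W' s u := W u /\ R u s.
pose P1 s := exists t, fat k.+1 (fun w => R (ext w t)) (fun w => W' s (ext w t)).
pose P2 s := hasint (fun t => fat k (fun w => R (ext w t)) (fun w => W' s (ext w t))).
have hQ j : def2 (fun s t => fat j (fun w => R (ext w t)) (fun w => W' s (ext w t))).
  move=> n t1 t2 h1 h2; apply: (@D_fat j m n (fun x w => R (ext w (t2 x)))
    (fun x w => W' (t1 x) (ext w (t2 x)))); rewrite /W'; dsolve.
have hQ1 := hQ k.+1; have hQ2 := hQ k; clear hQ.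
have hP1 : def1 P1 by rewrite /P1; dsolve.
have hP2 : def1 P2 by rewrite /P2 /hasint; dsolve.
have h12 : hasint (fun s => P1 s \/ P2 s).
  by apply: hasint_mono hfat => s; apply: IH; rewrite /W'; dsolve.
case: (hasint_or hP1 h12) => h.
  have [//|[t ht]|h1] := hasint_fiber_or_image hP1 hQ1 h; first by left; exists t.
  right; apply: hasint_mono h1 => t [s [_]]; apply: fat_mono => w; by case.
right; exact: (hasint_swap hP2 hQ2 h).
Qed.

(** Each parameter coordinate is fixed at the cost of at most one level, so one generic point is
    left when no parameter remains, and [pt M 0] has a single element. *)
Lemma fat_hasint m (R : pt M m -> M -> Prop) (W : pt M m -> Prop) :
  def2 R -> def1 W -> fat m.+1 R W -> exists u, W u /\ hasint (R u).
Proof.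
elim: m R W => [|m IH] R W hR hW h.
  have e (u v : pt M 0) : u = v by apply: functional_extensionality => -[].
  have [s [u [hu _]]] := hasint_ex h; exists u; split=> //.
  by apply: hasint_mono h => s' [u' [_ h']]; rewrite (e u u').
suff [t /IH [||w [h1 h2]]] : exists t, fat m.+1 (fun w => R (ext w t)) (fun w => W (ext w t)).
- by dsolve.
- by dsolve.
- by exists (ext w t).
case: (fat_slice hR hW h) => [[t ht]|/hasint_ex //].
by exists t; apply: fat_pred.
Qed.

Lemma directed_hasint m (R : pt M m -> M -> Prop) (W : pt M m -> Prop) :
  def2 R -> def1 W ->
  (forall u v, W u -> W v -> exists w, W w /\ forall s, R u s \/ R v s -> R w s) ->
  hasint (fun s => exists u, W u /\ R u s) -> exists u, W u /\ hasint (R u).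
Proof.
move=> hR hW hdir hcov; apply: fat_hasint => //.
(* Directedness gives fatness at every level: the induction runs over the members containing [R u0],
   and [u0] is enlarged to absorb each new generic point. *)
suff h k u0 : W u0 -> fat k R (fun u => W u /\ forall s, R u0 s -> R u s).
  have [s [u0 [h1 _]]] := hasint_ex hcov.
  by apply: fat_mono (h m.+1 u0 h1) => u [].
elim: k u0 => [|k IH] u0 Wu0; first by exists u0.
apply: hasint_mono hcov => s [u1 [Wu1 Rs]].
have [u2 [Wu2 h2]] := hdir u0 u1 Wu0 Wu1.
apply: fat_mono (IH u2 Wu2) => u [Wu hu]; split.
  by split=> // s' hs'; apply: hu; apply: h2; left.
by apply: hu; apply: h2; right.
Qed.
(** * Definable choice *)

Lemma description q (E : pt M q -> M -> Prop) : def2 E ->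
  (forall x, exists y, E x y) -> (forall x y y', E x y -> E x y' -> y = y') ->
  exists f : pt M q -> M, deff f /\ forall x, E x (f x).
Proof.
move=> hE hex hun.
pose f x := proj1_sig (constructive_indefinite_description _ (hex x)).
have hf x : E x (f x) by exact: proj2_sig.
exists f; split=> //.
have tf : tm f.
  apply: (@D_ext _ (fun z => E (init z) (last z))); last by dsolve.
  by move=> z; split=> [h|->]; [apply: hun h _|].
by move=> n t ht; apply: tm_comp.
Qed.

Definition is_inf (S : M -> Prop) m :=
  (forall t, S t -> ~ lt t m) /\ (forall t, lt m t -> exists t', S t' /\ lt t' t).
Definition is_sup (S : M -> Prop) m :=
  (forall t, S t -> ~ lt m t) /\ (forall t, lt t m -> exists t', S t' /\ lt t t').

Lemma is_inf_uniq (S : M -> Prop) m m' : is_inf S m -> is_inf S m' -> m = m'.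
Proof.
move=> [h1 h2] [h3 h4]; apply: le_anti => h.
  by have [t [/h3 ht ht']] := h2 _ h.
by have [t [/h1 ht ht']] := h4 _ h.
Qed.

Lemma is_sup_uniq (S : M -> Prop) m m' : is_sup S m -> is_sup S m' -> m = m'.
Proof.
move=> [h1 h2] [h3 h4]; apply: le_anti => h.
  by have [t [/h1 ht ht']] := h4 _ h.
by have [t [/h3 ht ht']] := h2 _ h.
Qed.

Lemma le_addl z x y : ~ lt y x -> ~ lt (add z y) (add z x).
Proof. by move=> h /(lt_addl (opp z)); rewrite !addKl. Qed.

Lemma le_addr z x y : ~ lt y x -> ~ lt (add y z) (add x z).
Proof. by move=> h /(lt_addr (opp z)); rewrite -!(og_assoc OG) addNr !(og_zeror OG). Qed.

Arguments le_addl z [x y] _ _.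
Arguments le_addr z [x y] _ _.

(* [sup {t | t + t <= e}] is [e / 2], but only [0 < _ < e] is needed, and this
   does not require commutativity. *)
Definition is_half e h := is_sup (fun t => ~ lt e (add t t)) h.

Lemma half_ex e : lt zero e -> exists h, is_half e h /\ lt zero h /\ lt h e.
Proof.
move=> he; have [d [hd1 hd2]] := dense he.
have h1 : lt zero (add (opp d) e) by rewrite -(addNl d); apply: lt_addl.
have [t [ht1 [ht2 ht3]]] := min_above hd1 h1.
have htt : ~ lt e (add t t).
  have := le_addl t ht3; have := le_addr (add (opp d) e) ht2.
  by rewrite addNKl; ord.
have h2 : lt (add e (opp d)) e.
  by move: (lt_addpos (add e (opp d)) hd1); rewrite addNKr.
have [k [hk1 [hk2 hk3]]] := max_below hd2 h2.
have hub s : ~ lt e (add s s) -> ~ lt k s.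
  move=> hs hks; apply: hs.
  have h3 : lt d s by ord.
  have h4 : lt (add e (opp d)) s by ord.
  by have := lt_addl s h3; have := lt_addr d h4; rewrite addNKr; ord.
have hS : def1 (fun t => ~ lt e (add t t)) by dsolve.
have [h [hh1 hh2]] := sup_ex hS (ex_intro _ t htt) hub.
exists h; split=> //; split; first by have := hh1 t htt; ord.
apply: NNPP => hn; have [|s [/hub hs hks]] := hh2 k; ord.
Qed.

(** A canonical element of a set bounded below: the infimum if attained, otherwise a point inside
    the initial interval starting there. The cap [one] keeps the length of that interval bounded
    when [S] contains a whole ray. *)
Definition pick one (S : M -> Prop) y := exists m, is_inf S m /\
  (S m /\ y = m \/
   ~ S m /\ exists e h, is_sup (fun e => lt zero e /\ ~ lt one e /\
       forall s, lt m s -> lt s (add m e) -> S s) e /\ is_half e h /\ y = add m h).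

Lemma pick_uniq one (S : M -> Prop) y y' : pick one S y -> pick one S y' -> y = y'.
Proof.
move=> [m [hm h]] [m' [hm' h']]; have e := is_inf_uniq hm hm'; subst m'.
case: h => [[h ->]|[h [e1 [h1 [he1 [hh1 ->]]]]]]; case: h' => [[h' ->]|[h' [e2 [h2 [he2 [hh2 ->]]]]]] //.
have e := is_sup_uniq he1 he2; subst e2.
by rewrite (is_sup_uniq hh1 hh2).
Qed.

Lemma pick_ex one (S : M -> Prop) b : lt zero one -> def1 S -> (exists t, S t) ->
  (forall t, S t -> ~ lt t b) -> exists y, pick one S y /\ S y.
Proof.
move=> hone hS hex hb; have [m [hm1 hm2]] := inf_ex hS hex hb.
have [Sm|Sm] := classic (S m); first by exists m; split=> //; exists m; split=> //; left.
have [[r [hr1 hr2]]|[r [hr1 hr2]]] := rgerm_dich m hS; last first.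
  have [t [ht1 ht2]] := hm2 _ hr1; case: (hr2 t) => //.
  by have [h|[h|//]] := og_total OG t m; [case: (hm1 t)|subst].
pose E e := lt zero e /\ ~ lt one e /\ forall s, lt m s -> lt s (add m e) -> S s.
have hE : def1 E by rewrite /E; dsolve.
have h1 : lt zero (add (opp m) r) by rewrite -(addNl m); apply: lt_addl.
have [e0 [he1 [he2 he3]]] := min_above hone h1.
have Ee0 : E e0.
  split=> //; split=> // s h2 h3; apply: hr2 => //.
  by have := le_addl m he3; rewrite addNKl; ord.
have [|e [ub lub]] := sup_ex (b := one) hE (ex_intro _ e0 Ee0); first by move=> t [_ []].
have hpos : lt zero e by have := ub e0 Ee0; ord.
have [h [hh [hh0 hhe]]] := half_ex hpos.
exists (add m h); split.
  by exists m; split=> //; right; split=> //; exists e, h.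
have [e' [[_ [_ he']] hlt]] := lub _ hhe; apply: he'; first exact: lt_addpos.
exact: lt_addl.
Qed.

Lemma choice1 q (S : pt M q -> M -> Prop) : def2 S ->
  exists f : pt M q -> M, deff f /\ forall x y, S x y -> S x (f x).
Proof.
move=> hS; have [one hone] := dn_nomax DN zero; have hopp := tm_opp.
(* [pick] needs a lower bound, so the nonnegative part of a fibre is tried first, then the reflected
   nonpositive part; an empty fibre gets the default [zero]. *)
pose pos x := exists s, ~ lt s zero /\ S x s.
pose A x t := ~ lt t zero /\ S x t.
pose B x t := ~ lt t zero /\ S x (opp t).
pose E x y := pos x /\ pick one (A x) y \/ ~ pos x /\ (exists t, B x t) /\ pick one (B x) (opp y)
  \/ ~ pos x /\ ~ (exists t, B x t) /\ y = zero.
have hE : def2 E by rewrite /E /pos /pick /is_half /is_inf /is_sup /A /B; dsolve.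
have hA x : def1 (A x) by rewrite /A; dsolve.
have hB x : def1 (B x) by rewrite /B; dsolve.
have hex x : exists y, E x y /\ ((exists t, S x t) -> S x y).
  have [[s hs]|hp] := classic (pos x).
    have [||y [hy [_ hy']]] := pick_ex (b := zero) hone (hA x); first by exists s.
      by move=> t [].
    by exists y; split=> //; left; split=> //; exists s.
  have [hb|hb] := classic (exists t, B x t).
    have [|y [hy [_ hy']]] := pick_ex (b := zero) hone (hB x) hb; first by move=> t [].
    by exists (opp y); split=> //; right; left; rewrite oppK.
  exists zero; split; first by right; right.
  move=> [t ht]; case: hb; exists (opp t); split; last by rewrite oppK.
  move=> h; apply: hp; exists t; split=> // h'.
  have := lt_opp h'; have -> : opp zero = zero by rewrite -[LHS](og_zeror OG) addNl.
  by ord.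
have [||f [df hf]] := description hE.
- by move=> x; have [y [h _]] := hex x; exists y.
- move=> x y y' [[h1 h2]|[[h1 [h2 h3]]|[h1 [h2 h3]]]] [[h1' h2']|[[h1' [h2' h3']]|[h1' [h2' h3']]]] //.
  + exact: pick_uniq h2 h2'.
  + by rewrite -(oppK y) -(oppK y'); congr opp; apply: pick_uniq h3 h3'.
  + by subst.
exists f; split=> // x y Sxy; have [y' [h1 h2]] := hex x.
suff -> : f x = y' by apply: h2; exists y.
move: (hf x) h1 => [[h1 h3]|[[h1 [h4 h3]]|[h1 [h4 h3]]]] [[h1' h3']|[[h1' [h4' h3']]|[h1' [h4' h3']]]] //.
+ exact: pick_uniq h3 h3'.
+ by rewrite -(oppK y') -(oppK (f x)); congr opp; apply: pick_uniq h3 h3'.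
+ by rewrite h3'.
Qed.

Lemma choice_vec q d (S : pt M q -> pt M d -> Prop) : def2 S ->
  exists f : pt M q -> pt M d, deff f /\ forall x v, S x v -> S x (f x).
Proof.
elim: d S => [|d IH] S hS.
  exists (fun _ _ => zero); split=> [n t ht|x v hv]; first exact: tm_constv.
  by have -> : (fun=> zero) = v by apply: functional_extensionality => -[].
have h1 : def2 (fun x y => exists v, S x (ext v y)) by dsolve.
have [f [df hf]] := choice1 h1.
have h2 : def2 (fun x v => S x (ext v (f x))) by dsolve.
have [g [dg hg]] := IH _ h2; exists (fun x => ext (g x) (f x)); split; first by dsolve.
move=> x v hv; have [|w hw] := hf x (last v); last exact: hg hw.
by exists (init v); rewrite ext_init_last.
Qed.
(** * Accumulation points in definable topological spaces *)

Variable T : dtop M.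
Hypothesis HT : is_dts D T.
Hypothesis Hreg : regular T.
Local Notation P := (pt M (dim T)).
Variables (C : P -> Prop) (x : P).
Hypothesis Hx : carrier T x.

(** Index condition and membership are kept together because [is_dts] makes only their conjunction
    definable. *)
Definition bs (u : pt M (pdim T)) (y : P) := bidx T u /\ bset T u y.

Lemma def2_bs : def2 bs.
Proof. by case: HT => _ [_ [h _]]; apply: def2P. Qed.

Lemma def1_carrier : def1 (carrier T).
Proof. by case: HT => h _; apply: def1P. Qed.

Lemma bs_carrier u y : bs u y -> carrier T y.
Proof. by case: HT => _ [_ [_ [h _]]] [h1 h2]; apply: h h2. Qed.

Lemma bs_ex y : carrier T y -> exists u, bs u y.
Proof. by case: HT => _ [_ [_ [_ [h _]]]] /h. Qed.

Lemma bs_inter u v y : bs u y -> bs v y ->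
  exists w, bs w y /\ forall z, bs w z -> bs u z /\ bs v z.
Proof.
case: HT => _ [_ [_ [_ [_ h]]]] [hu1 hu2] [hv1 hv2].
have [w [h1 [h2 h3]]] := h u v y hu1 hv1 hu2 hv2.
by exists w; split=> // z [_ /h3 []].
Qed.

Definition NB (N : P -> Prop) := exists u, bs u x /\ forall y, bs u y -> N y.

Lemma nbhd_NB (N : P -> Prop) : nbhd T x N -> NB N.
Proof. by move=> [u [h1 [h2 h3]]]; exists u; split=> // y [_ /h3]. Qed.

Lemma NB_mono (N N' : P -> Prop) : (forall y, N y -> N' y) -> NB N -> NB N'.
Proof. by move=> h [u [h1 h2]]; exists u; split=> // y /h2 /h. Qed.

Lemma NB_and (N N' : P -> Prop) : NB N -> NB N' -> NB (fun y => N y /\ N' y).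
Proof.
move=> [u [h1 h2]] [v [h3 h4]]; have [w [h5 h6]] := bs_inter h1 h3.
by exists w; split=> // y /h6 [/h2 ? /h4].
Qed.

Lemma NB_carrier : NB (carrier T).
Proof. by have [u hu] := bs_ex Hx; exists u; split=> // y /bs_carrier. Qed.

Definition clo (F : P -> Prop) := (forall y, F y -> carrier T y) /\
  forall y, carrier T y -> ~ F y -> exists u, bs u y /\ forall z, bs u z -> ~ F z.

Lemma clo_and (F G : P -> Prop) : clo F -> clo G -> clo (fun y => F y /\ G y).
Proof.
move=> [hF1 hF2] [hG1 hG2]; split=> [y [/hF1]|y hy /not_and_or [] h] //.
  by have [u [h1 h2]] := hF2 y hy h; exists u; split=> // z /h2 h3 [].
by have [u [h1 h2]] := hG2 y hy h; exists u; split=> // z /h2 h3 [].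
Qed.

Lemma clo_bigcap (I : Type) (Q : I -> Prop) (F : I -> P -> Prop) :
  (forall i, clo (F i)) -> clo (fun y => carrier T y /\ forall i, Q i -> F i y).
Proof.
move=> hF; split=> [y []|y hy h] //.
have [i [Qi hi]] : exists i, Q i /\ ~ F i y.
  apply: NNPP => hn; apply: h; split=> // i Qi; apply: NNPP => h.
  by apply: hn; exists i.
have [_ hFi] := hF i; have [u [h1 h2]] := hFi y hy hi.
by exists u; split=> // z /h2 h3 [_ h4]; apply: h3; apply: h4.
Qed.

Lemma clo_compl u : clo (fun y => carrier T y /\ ~ bs u y).
Proof.
split=> [y []|y hy h] //; exists u; split; first by apply: NNPP => h'; apply: h.
by move=> z h1 [].
Qed.

Definition cl (v : pt M (pdim T)) (y : P) :=
  carrier T y /\ forall u, bs u y -> exists z, bs u z /\ bs v z.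

Lemma def2_cl : def2 cl.
Proof. by rewrite /cl; have h1 := def2_bs; have h2 := def1_carrier; dsolve. Qed.

Lemma def1_and_cl (Z : P -> Prop) v : D Z -> def1 (fun y => Z y /\ cl v y).
Proof. by move=> /def1P hZ; have h := def2_cl; dsolve. Qed.

Lemma clo_cl v : clo (cl v).
Proof.
split=> [y []|y hy h] //.
have [u [h1 h2]] : exists u, bs u y /\ ~ exists z, bs u z /\ bs v z.
  apply: NNPP => hn; apply: h; split=> // u hu; apply: NNPP => h.
  by apply: hn; exists u.
by exists u; split=> // z hz [_ /(_ u hz)].
Qed.

Lemma bs_cl v y : bs v y -> cl v y.
Proof. by move=> h; split=> [|u hu]; [apply: bs_carrier h|exists y]. Qed.

Lemma regular_cl u y : bs u y -> exists v, bs v y /\ forall z, cl v z -> bs u z.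
Proof.
move=> h; have [h1 h2] := h.
have [v [h3 [h4 h5]]] := Hreg (bs_carrier h) h1 h2.
exists v; split=> // z [hz1 hz2]; split=> //; apply: h5; split=> // w hw1 hw2.
by have [z' [[_ ?] [_ ?]]] := hz2 w (conj hw1 hw2); exists z'.
Qed.

Definition acc (Z : P -> Prop) :=
  forall u, bs u x -> exists y, bs u y /\ Z y /\ y <> x.

Lemma acc_mono (Z Z' : P -> Prop) : (forall y, Z y -> Z' y) -> acc Z -> acc Z'.
Proof. by move=> h hZ u /hZ [y [h1 [/h h2 h3]]]; exists y. Qed.

Lemma acc_NB (Z N : P -> Prop) : acc Z -> NB N -> acc (fun y => Z y /\ N y).
Proof.
move=> hZ [v [h1 h2]] u hu; have [w [h3 h4]] := bs_inter hu h1.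
by have [y [/h4 [h5 /h2 h6] [h7 h8]]] := hZ w h3; exists y.
Qed.

Hypothesis HaccC : acc C.

Definition has_curve := exists g : M -> P, def_curve lt zero D g /\
  (forall t, lt zero t -> C (g t) /\ g t <> x) /\
  (conv_left lt zero D T g x \/ conv_right lt zero D T g x).

Lemma def_curveP (g : M -> P) : deff g -> def_curve lt zero D g.
Proof.
move=> hg; apply: D_and; first by dsolve.
by apply: D_ord => i; dsolve.
Qed.

Lemma has_curve_right (g : M -> P) : deff g -> (forall t, C (g t) /\ g t <> x) ->
  (forall u t, bs u x -> exists s, lt t s /\ bs u (g s)) -> has_curve.
Proof.
move=> hg hgC h; exists g; split; first exact: def_curveP; split=> [t _|] //; right.
split=> // t ht A _ /nbhd_NB [u [h1 h2]].
by have [s [h3 /h2 h4]] := h u t h1; exists s.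
Qed.

Lemma has_curve_left (g : M -> P) : deff g -> (forall t, C (g t) /\ g t <> x) ->
  (forall u t, bs u x -> lt zero t -> exists s, lt zero s /\ lt s t /\ bs u (g s)) ->
  has_curve.
Proof.
move=> hg hgC h; exists g; split; first exact: def_curveP; split=> [t _|] //; left.
split=> // t ht A _ /nbhd_NB [u [h1 h2]].
by have [s [h3 [h4 /h2 h5]]] := h u t h1 ht; exists s.
Qed.

(* The neighbourhood filter of [x] pulled back along [g] concentrates at an
   end of the line or on one side of a point, where [g] is reparametrised. *)
Lemma has_curve_of_fun (g : M -> P) : deff g -> (forall t, C (g t) /\ g t <> x) ->
  (forall u, bs u x -> exists t, bs u (g t)) -> has_curve.
Proof.
move=> hg hgC hx; have dbs := def2_bs; have hopp := tm_opp.
(* [good S]: the preimage of every neighbourhood of [x] meets [S]. As neighbourhoods are directed, a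
   union of two sets is good only if one of them is. *)
pose good (S : M -> Prop) := forall u, bs u x -> exists t, S t /\ bs u (g t).
have good_or S S' : good (fun t => S t \/ S' t) -> good S \/ good S'.
  move=> h; apply: NNPP => /not_or_and [].
  move=> /not_all_ex_not [u /not_all_ex_not [hu hu']].
  move=> /not_all_ex_not [v /not_all_ex_not [hv hv']].
  have [w [h1 h2]] := bs_inter hu hv.
  have [t [[ht|ht] /h2 [h3 h4]]] := h w h1; first by apply: hu'; exists t.
  by apply: hv'; exists t.
have good_mono S S' : (forall t, S t -> S' t) -> good S -> good S'.
  by move=> h hS u /hS [t [/h h1 h2]]; exists t.
have [h|/not_all_ex_not [b hb]] := classic (forall b, good (lt b)).
  by apply: (has_curve_right hg) => // u t hu; apply: h.
have [h|/not_all_ex_not [a ha]] := classic (forall a, good (fun t => lt t a)).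
  apply: (has_curve_right (g := fun t => g (opp t))) => //; first by dsolve.
  move=> u t hu; have [s [h1 h2]] := h (opp t) u hu.
  by exists (opp s); rewrite oppK; split=> //; have := lt_opp h1; rewrite oppK.
(* Neither end of the line being good, the infimum [c] of the good initial rays exists, and every
   interval [(l, r]] around [c] is good. *)
pose J y := good (fun t => ~ lt y t).
have hJ : def1 J by rewrite /J /good; dsolve.
have [||c [hc1 hc2]] := inf_ex (b := a) hJ.
- exists b; case: (good_or (fun t => ~ lt b t) (lt b)) => // u hu.
  have [t ht] := hx u hu; exists t; split=> //.
  by have [h|h] := classic (lt b t); [right|left].
- by move=> t Jt hta; apply: ha; apply: good_mono Jt => s; ord.
have hlr l r : lt l c -> lt c r -> good (fun t => lt l t /\ ~ lt r t).
  move=> hl hr; have [t [Jt htr]] := hc2 r hr.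
  case: (good_or (fun s => ~ lt l s) (fun s => lt l s /\ ~ lt r s)) => [|h|//].
    apply: good_mono Jt => s hs; have [h|h] := classic (lt l s); [right|left] => //.
    by ord.
  by case: (hc1 l).
have [h|h] := classic (good (fun t => t = c)).
  apply: (has_curve_right (g := fun _ => g c)) => //; first by dsolve.
  move=> u t hu; have [s [-> hs]] := h u hu; have [s' hs'] := dn_nomax DN t.
  by exists s'.
have hlr' l r : lt l c -> lt c r ->
    good (fun t => lt l t /\ lt t c) \/ good (fun t => lt c t /\ ~ lt r t).
  move=> hl hr; case: (good_or (fun t => t = c)
    (fun t => lt l t /\ lt t c \/ lt c t /\ ~ lt r t)) => // [|h1]; last exact: good_or.
  apply: good_mono (hlr l r hl hr) => t [h1 h2].
  by have [h3|[h3|h3]] := og_total OG t c; [right; left|left|right; right].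
have [h1|/not_all_ex_not [r /not_all_ex_not [hr h1]]] :=
    classic (forall r, lt c r -> good (fun t => lt c t /\ ~ lt r t)).
  apply: (has_curve_left (g := fun t => g (add c t))) => //; first by dsolve.
  move=> u t hu ht; have [t' [ht1 ht2]] := dense ht.
  have [s [[h3 h4] h5]] := h1 _ (lt_addpos c ht1) u hu.
  exists (add (opp c) s); rewrite addNKl; split.
    by rewrite -(addNl c); apply: lt_addl.
  split=> //; apply: le_lt_trans ht2 => h6; apply: h4.
  by have := lt_addl c h6; rewrite addNKl.
apply: (has_curve_left (g := fun t => g (add c (opp t)))) => //; first by dsolve.
move=> u t hu ht.
have hct : lt (add c (opp t)) c.
  by move: (lt_addpos (add c (opp t)) ht); rewrite addNKr.
case: (hlr' _ r hct hr) => // h2; have [s [[h3 h4] h5]] := h2 u hu.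
have h6 := lt_addl (opp c) h3; rewrite addKl in h6.
have h7 := lt_addl (opp c) h4; rewrite addNl in h7.
exists (opp (add (opp c) s)); rewrite oppK addNKl.
split; last by split=> //; have := lt_opp h6; rewrite oppK.
have := lt_opp h7; suff -> : opp zero = zero by [].
by rewrite -[LHS](og_zeror OG) addNl.
Qed.

Lemma has_curve_of_family (H : M -> P -> Prop) : def2 H ->
  (forall t y, H t y -> C y /\ y <> x) ->
  (forall u, bs u x -> exists t, (exists y, H t y) /\ forall y, H t y -> bs u y) ->
  has_curve.
Proof.
move=> hH hHC hu.
have [u0 hu0] := bs_ex Hx; have [y0 [_ [Cy0 hy0]]] := HaccC hu0.
(* Empty members receive the default [y0], which keeps the chosen points in [C] and away from
   [x]. *)
pose H' (v : pt M 1) y := H (v ord0) y \/ ~ (exists y, H (v ord0) y) /\ y = y0.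
have hH' : def2 H' by rewrite /H'; dsolve.
have [f [df hf]] := choice_vec hH'.
have hfH t : H' (pt1 t) (f (pt1 t)).
  have [[y hy]|hn] := classic (exists y, H t y); first by apply: (hf _ y); left.
  by apply: (hf _ y0); right.
apply: (@has_curve_of_fun (fun t => f (pt1 t))).
- by move=> n t ht; apply: df; constructor.
- by move=> t; case: (hfH t) => [/hHC //|[_ ->]].
move=> u /hu [t [hex h]]; exists t; case: (hfH t) => [/h //|[hn _]].
by case: hn.
Qed.

(** * Chains of closed sets inside a definably compact set *)

Variable K : P -> Prop.
Hypothesis HKC : def_compact D T K.
Variable Y : P -> Prop.
Hypotheses (HYD : def1 Y) (HYclo : clo Y) (HYC : forall y, Y y -> C y).
Hypothesis HYK : forall y, Y y -> K y.
Hypothesis HKcar : forall y, K y -> carrier T y.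

Lemma chain_compact (F : M -> P -> Prop) : def2 F -> (forall t, clo (F t)) ->
  (forall t y, F t y -> Y y) -> (forall t, exists y, F t y) ->
  (forall t t', (forall y, F t y -> F t' y) \/ (forall y, F t' y -> F t y)) ->
  exists y, forall t, F t y.
Proof.
move=> hF hclo hFY hex hch.
have [|||||y hy] := HKC (V := fun _ : pt M 1 => True) (F := fun v => F (v ord0)).
- exact: D_const.
- by apply: D_and; [apply: D_const | dsolve].
- by exists (fun _ => zero).
- move=> v _; split=> //; split=> [y /hFY /HYK //|y hy h].
  have [_ h2] := hclo (v ord0); have [u [[h3 h4] h5]] := h2 y (HKcar hy) h.
  by exists u; split=> //; split=> // z hz _; apply: h5.
- move=> v1 v2 _ _; case: (hch (v1 ord0) (v2 ord0)) => h; [exists v1|exists v2];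
  by split=> // y hy; split=> //; apply: h.
by exists y => t; apply: (hy (fun _ => t)).
Qed.

(** If the sets [Z /\ G t], cut down to a small neighbourhood of [x] and punctured at [x], shrink to
    [x], they yield a curve. Otherwise some [w] is never reached, and compactness applied to their
    closed parts outside [bs w] gives a point other than [x] in the whole intersection. *)
Lemma chain_acc (Z : P -> Prop) (G : M -> P -> Prop) : def1 Z -> clo Z ->
  (forall y, Z y -> Y y) -> def2 G -> (forall t, clo (G t)) ->
  (forall t t', (forall y, G t y -> G t' y) \/ (forall y, G t' y -> G t y)) ->
  (forall t, acc (fun y => Z y /\ G t y)) ->
  has_curve \/ acc (fun y => Z y /\ forall t, G t y).
Proof.
move=> hZ cZ hZY hG cG hch hacc; apply: NNPP => /not_or_and [hnc].
move=> /not_all_ex_not [u /not_all_ex_not [hu hu']].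
have [v [hv hvu]] := regular_cl hu.
have dbs := def2_bs; have dcar := def1_carrier; have dcl := def2_cl.
apply: hnc; apply: (@has_curve_of_family
  (fun t y => Z y /\ G t y /\ bs v y /\ y <> x)); first by dsolve.
- by move=> t y [/hZY /HYC ? [_ [_ ?]]].
move=> w hw; apply: NNPP => hn.
have hne t : exists y, (Z y /\ G t y /\ bs v y /\ y <> x) /\ ~ bs w y.
  apply: NNPP => hn2; apply: hn; exists t; split.
    by have [y [h1 [[h2 h3] h4]]] := hacc t v hv; exists y.
  by move=> y hy; apply: NNPP => h; apply: hn2; exists y.
have [|||||y hy] := @chain_compact (fun t y => (Z y /\ G t y) /\ (cl v y /\ (carrier T y /\ ~ bs w y))).
- by dsolve.
- move=> t; apply: clo_and; first exact: clo_and.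
  by apply: clo_and; [apply: clo_cl|apply: clo_compl].
- by move=> t y [[/hZY]].
- move=> t; have [y [[h1 [h2 [h3 h4]]] h5]] := hne t; exists y; split=> //.
  by split; [apply: bs_cl|split=> //; apply: bs_carrier h3].
- by move=> t t'; case: (hch t t') => h; [left|right] => y [[h1 /h h2] h3].
have [[Zy _] [cy [_ wy]]] := hy zero.
apply: hu'; exists y; split; first exact: hvu.
split; first by split=> // t; case: (hy t) => [[]].
by move=> e; apply: wy; rewrite e.
Qed.
(** * Chain-monotone families of neighbourhoods *)

(* The family is a chain in each coordinate of [pt M k], the direction of
   each inclusion being uniform in all the other parameters. *)
Fixpoint mono k : forall A : Type, (A -> pt M k -> P -> Prop) -> Prop :=
  match k with
  | 0 => fun _ _ => True
  | k'.+1 => fun A N =>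
    (forall t t', (forall a c y, N a (ext c t) y -> N a (ext c t') y) \/
                  (forall a c y, N a (ext c t') y -> N a (ext c t) y)) /\
    @mono k' (A * M)%type (fun p c => N p.1 (ext c p.2))
  end.

Lemma mono_bigcap k (A A' : Type) (N : A -> pt M k -> P -> Prop)
    (N' : A' -> pt M k -> P -> Prop) (G : A' -> A -> Prop) :
  (forall a' c y, N' a' c y <-> carrier T y /\ forall a, G a' a -> N a c y) ->
  mono N -> mono N'.
Proof.
elim: k A A' N N' G => [//|k IH] A A' N N' G hN' [h1 h2]; split.
  move=> t t'; case: (h1 t t') => h; [left|right] => a' c y /hN' [h3 h4];
  by apply/hN'; split=> // a /h4 /h.
apply: (IH _ _ _ _ (fun q' q => G q'.1 q.1 /\ q.2 = q'.2)) h2 => -[a' t] c y /=.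
split=> [/hN' [h3 h4]|[h3 h4]]; first by split=> // -[a s] /= [/h4 h5 ->].
by apply/hN'; split=> // a ha; apply: (h4 (a, t)).
Qed.

Lemma mono_acc k (A : Type) (N : A -> pt M k -> P -> Prop) a (Z : P -> Prop) :
  mono N -> def2 (N a) -> (forall c, clo (N a c)) -> (forall c, NB (N a c)) ->
  def1 Z -> clo Z -> (forall y, Z y -> Y y) -> acc Z ->
  has_curve \/ acc (fun y => Z y /\ forall c, N a c y).
Proof.
elim: k A N a => [|k IH] A N a hm hN cN nN hZ cZ hZY aZ.
  have e (u v : pt M 0) : u = v by apply: functional_extensionality => -[].
  right; apply: acc_mono (acc_NB aZ (nN (fun _ => zero))) => y [h1 h2].
  by split=> // c; rewrite (e c (fun _ => zero)).
have [hch hm'] := hm; have dcar := def1_carrier.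
have [hc|hnc] := classic has_curve; first by left.
(* The induction hypothesis at index [(a, t)] treats all coordinates but the last. Uniformity of the
   inclusions in [mono] makes these partial intersections a chain in [t]. *)
pose G t y := carrier T y /\ forall c, True -> N a (ext c t) y.
have hG : def2 G by rewrite /G; dsolve.
have [|||//|h] := chain_acc hZ cZ hZY hG.
- by move=> t; apply: clo_bigcap.
- by move=> t t'; case: (hch t t') => h; [left|right] => y [h1 h2]; split=> // c _; apply: h; apply: h2.
- move=> t.
  have [|||//|h] := IH _ _ (a, t) hm' _ _ _ hZ cZ hZY aZ => /=.
  + by dsolve.
  + by move=> c; apply: cN.
  + by move=> c; apply: nN.
  by apply: acc_mono h => y /= [h1 h2]; split=> //; split=> //; case: cZ => h3 _; apply: h3.
right; apply: acc_mono h => y [h1 h2]; split=> // c.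
by rewrite -(ext_init_last c); case: (h2 (last c)) => _; apply.
Qed.

(** * Bad parameters and their elimination *)

Definition bad (F : M -> P -> Prop) t := forall l r, lt l t -> lt t r ->
  ~ NB (fun y => forall t', lt l t' -> lt t' r -> F t' y).

(** Basic neighbourhoods of [x] are directed under shrinking, so one of them would lie in [F t] for
    all [t] in an interval of bad points. *)
Lemma bad_noint1 (F : M -> P -> Prop) : def2 F -> (forall t, NB (F t)) ->
  ~ hasint (bad F).
Proof.
move=> hF nF [a [b [hab hbad]]]; have dbs := def2_bs.
pose R u t := (lt a t /\ lt t b) /\ forall y, bs u y -> F t y.
have hR : def2 R by rewrite /R; dsolve.
have hW : def1 (fun u => bs u x) by dsolve.
have [||u [hu [p [q [hpq h]]]]] := directed_hasint hR hW.
- move=> u v hu hv; have [w [h1 h2]] := bs_inter hu hv; exists w; split=> // s.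
  by move=> [] [h3 h4]; split=> // y /h2 [] ? ?; apply: h4.
- exists a, b; split=> // s h1 h2; have [u [h3 h4]] := nF s.
  by exists u.
have [t [h1 h2]] := dense hpq; have [[h3 h4] _] := h t h1 h2.
apply: (hbad t h3 h4 p q h1 h2); exists u; split=> // y hy t' h5 h6.
by case: (h t' h5 h6) => _; apply.
Qed.

(** Chain parameters are fixed one at a time: smaller sets have more bad points, so the bad sets
    form a chain in the last coordinate and [chain_hasint] selects one value of it. *)
Lemma bad_noint k (A : Type) (N : A -> pt M k -> P -> Prop) (g : M -> A) :
  mono N -> def3 (fun t c y => N (g t) c y) -> (forall t c, NB (N (g t) c)) ->
  ~ hasint (fun t => exists c, bad (fun t' => N (g t') c) t).
Proof.
elim: k A N g => [|k IH] A N g hm hN nN.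
  have e (u v : pt M 0) : u = v by apply: functional_extensionality => -[].
  move=> h; have [||] := @bad_noint1 (fun t' => N (g t') (fun _ => zero)) => //.
    by dsolve.
  apply: hasint_mono h => t [c]; by rewrite (e c (fun _ => zero)).
have [hch hm'] := hm; have dbs := def2_bs.
pose S s t := exists c, bad (fun t' => N (g t') (ext c s)) t.
have hS : def2 S by rewrite /S /bad /NB; dsolve.
have hT : def1 (fun _ : M => True) by dsolve.
move=> h; have [||s [_ hs]] := chain_hasint hT hS.
- move=> s s'; case: (hch s s') => hh; [right|left] => t [c hc]; exists c => l r hl hr hnb;
  by apply: (hc l r hl hr); apply: NB_mono hnb => y hy t' h1 h2; apply: hh; apply: hy.
- apply: hasint_mono h => t [c hc]; exists (last c); split=> //; exists (init c).
  by rewrite ext_init_last.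
by apply: (IH _ _ (fun t => (g t, s)) hm' _ _ hs) => /=; [dsolve|move=> t c; apply: nN].
Qed.

(** A Heine-Borel argument: the right ends reachable from [a] have a supremum, and the local
    hypothesis there reaches beyond it unless [b] is attained. *)
Lemma NB_interval (F : M -> P -> Prop) (S : M -> Prop) a b : def2 F -> def1 S ->
  (forall y, exists l r, lt l y /\ lt y r /\
     NB (fun z => forall t, S t -> lt l t -> lt t r -> F t z)) ->
  NB (fun z => forall t, S t -> ~ lt t a -> ~ lt b t -> F t z).
Proof.
move=> hF hS hloc; have dbs := def2_bs.
have [hba|hab] := classic (lt b a).
  by apply: NB_mono NB_carrier => y _ t _ h1 h2; case: h2; ord.
pose J y := ~ lt y a /\ ~ lt b y /\ NB (fun z => forall t, S t -> ~ lt t a -> ~ lt y t -> F t z).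
have hJ : def1 J by rewrite /J /NB; dsolve.
have Ja : J a.
  split; [ord|split=> //]; have [l [r [hl [hr h]]]] := hloc a.
  by apply: NB_mono h => z h t St h1 h2; apply: h => //; ord.
have [|y [ub lub]] := sup_ex (b := b) hJ (ex_intro _ a Ja); first by move=> t [_ []].
have [l [r [hl [hr h]]]] := hloc y; have [y0 [[h1 [h2 h3]] hly0]] := lub _ hl.
have hext y' : lt y' r -> NB (fun z => forall t, S t -> ~ lt t a -> ~ lt y' t -> F t z).
  move=> hy'; apply: NB_mono (NB_and h3 h) => z [h4 h5] t St h6 h7.
  have [h8|h8] := classic (lt y0 t); last exact: h4.
  by apply: h5 => //; ord.
have [hbr|hbr] := classic (lt b r); first exact: hext.
have [y' [h4 h5]] := dense hr; case: (ub y') => //.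
by have := ub _ Ja => hya; split; [ord|split; [ord|apply: hext]].
Qed.

(* [B] collects the parameters near which the family has no common
   neighbourhood; it is discrete.  Away from [B], the intersection over a
   closed bounded set of parameters is still a neighbourhood, so two chain
   parameters, a bound [r] on [t] and a distance [e] to [B], replace [t]. *)
Lemma eliminate_param p k (N : pt M p.+1 -> pt M k -> P -> Prop) :
  mono N -> def3 N -> (forall v c, clo (N v c)) -> (forall v c, NB (N v c)) ->
  exists N' : pt M p -> pt M k.+2 -> P -> Prop,
    mono N' /\ def3 N' /\ (forall v c, clo (N' v c)) /\ (forall v c, NB (N' v c)) /\
    forall v y, (forall c, N' v c y) -> forall t c, N (ext v t) c y.
Proof.
move=> hm hN cN nN; have dbs := def2_bs; have dcar := def1_carrier.
pose B v t := exists c, bad (fun t' => N (ext v t') c) t.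
have hB : def2 B by rewrite /B /bad /NB; dsolve.
have hBv v : def1 (B v) by dsolve.
have Bnoint v : ~ hasint (B v).
  by apply: (@bad_noint k _ N (fun t => ext v t)) => //; dsolve.
(* The bound [|t| < r] is again written without subtraction. For [e] not positive the set is empty
   and [N'] is the whole space, which keeps [N'] a chain in [e]. *)
pose S v r e t := lt zero e /\ lt zero (add t r) /\ lt t r /\
  (B v t \/ ~ exists b, B v b /\ near t b e).
have Sr v r r' e t : ~ lt r' r -> S v r e t -> S v r' e t.
  move=> h [h1 [h2 [h3 h4]]]; split=> //; have := le_addl t h => h5.
  by split; [ord|split=> //; ord].
have Se v r e e' t : lt zero e' -> ~ lt e e' -> S v r e t -> S v r e' t.
  move=> h0 h [h1 [h2 [h3 h4]]]; split=> //; split=> //; split=> //.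
  case: h4 => h4; [by left|right] => -[b [h5 h6]]; apply: h4; exists b; split=> //.
  exact: near_mono h6.
pose N' v (c' : pt M k.+2) y := carrier T y /\ forall t,
  S v (last (init c')) (last c') t -> N (ext v t) (init (init c')) y.
exists N'; split; last split; last split; last split.
- split; last split.
  + move=> e e'; rewrite /N'.
    have [he|he] := classic (lt zero e); last first.
      by right=> v c y [h1 h2]; rewrite last_ext; split=> // t [].
    have [he'|he'] := classic (lt zero e'); last first.
      by left=> v c y [h1 h2]; rewrite last_ext; split=> // t [].
    have [h|h] := classic (lt e e'); [left|right] => v c y; rewrite !last_ext !init_ext;
    move=> [h1 h2]; split=> // t ht; apply: h2; apply: Se ht => //; ord.
  + move=> r r'; rewrite /N'.
    have [h|h] := classic (lt r r'); [right|left] => v c y /=;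
    rewrite !(last_ext, init_ext);
    move=> [h1 h2]; split=> // t ht; apply: h2; apply: Sr ht => //; ord.
  apply: (mono_bigcap (G := fun q v => exists t, S q.1.1 q.2 q.1.2 t /\ v = ext q.1.1 t)) hm.
  move=> [[v e] r] c y /=; rewrite /N' !(last_ext, init_ext).
  split=> -[h1 h2]; split=> //; first by move=> w [t [h3 ->]]; apply: h2.
  by move=> t ht; apply: h2; exists t.
- by rewrite /N' /S /near; dsolve.
- move=> v c; exact: (@clo_bigcap M _ (fun t => N (ext v t) (init (init c)))).
- move=> v c; apply: NB_and; first exact: NB_carrier.
  set c0 := init (init c); set r := last (init c); set e := last c.
  have [he|he] := classic (lt zero e); last first.
    by apply: NB_mono NB_carrier => y _ t [].
  suff h : NB (fun z => forall t, S v r e t -> ~ lt t (opp r) -> ~ lt r t -> N (ext v t) c0 z).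
    apply: NB_mono h => y h t ht; have [_ [h1 [h2 _]]] := ht; apply: h => //; last by ord.
    by move=> /(lt_addr r); rewrite addNl; ord.
  apply: (@NB_interval (fun t => N (ext v t) c0)); [by dsolve|by rewrite /S /near; dsolve|].
  (* A point outside [B] has a common neighbourhood around it by definition. Around a bad [y], an
     interval that isolates [y] in [B] and stays within distance [e] contains no element of [S] but
     [y]. *)
  move=> y; have [By|By] := classic (B v y); last first.
    have [l [rr [hl [hr h]]]] : exists l rr, lt l y /\ lt y rr /\
        NB (fun z => forall t', lt l t' -> lt t' rr -> N (ext v t') c0 z).
      apply: NNPP => hn; apply: By; exists c0 => l rr hl hr h; apply: hn.
      by exists l, rr.
    by exists l, rr; split=> //; split=> //; apply: NB_mono h => z h t _; apply: h.
  have [l [rr [hl [hr h]]]] := noint_isolated y (hBv v) (@Bnoint v).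
  have h1 : lt (add y (opp e)) y.
    by move: (lt_addpos (add y (opp e)) he); rewrite addNKr.
  have [l' [hl' [hl1 hl2]]] := max_below hl h1.
  have [r' [hr' [hr1 hr2]]] := min_above hr (lt_addpos y he).
  exists l', r'; split=> //; split=> //; apply: NB_mono (nN (ext v y) c0) => z hz t.
  move=> [_ [_ [_ ht]]] htl htr; suff -> : t = y by [].
  case: ht => ht; first by apply: h => //; ord.
  case: ht; exists y; split=> //; split; first by ord.
  have h2 : lt (add y (opp e)) t by ord.
  by have := lt_addr e h2; rewrite addNKr.
move=> v y hy t c.
(* Every [t] enters some [S v r e]: any [e > 0] serves a bad [t], and any other [t] has a positive
   distance to the discrete set [B]. *)
suff [r [e ht]] : exists r e, S v r e t.
  by case: (hy (ext (ext c r) e)) => _; rewrite !(last_ext, init_ext); apply.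
have [r0 hr0] := dn_nomax DN t; have [r1 hr1] := dn_nomax DN (opp t).
have [r [h3 h4]] : exists r, ~ lt r r0 /\ ~ lt r r1.
  by have [h|h] := classic (lt r0 r1); [exists r1|exists r0]; split=> //; ord.
have h5 : lt zero (add t r) by rewrite -(addNr t); apply: lt_addl; ord.
exists r; have [Bt|Bt] := classic (B v t).
  have [e he] := dn_nomax DN zero; exists e; split=> //; split=> //.
  by split; [ord|left].
have [l [rr [hl [hr h]]]] := noint_isolated t (hBv v) (@Bnoint v).
have [e [he hen]] := near_small hl hr; exists e; split=> //; split=> //.
split; [ord|right] => -[b [Bb /hen [h6 h7]]]; apply: Bt.
by rewrite -(h b).
Qed.

Lemma eliminate_params p k (N : pt M p -> pt M k -> P -> Prop) :
  mono N -> def3 N -> (forall v c, clo (N v c)) -> (forall v c, NB (N v c)) ->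
  exists k' (N' : pt M 0 -> pt M k' -> P -> Prop),
    mono N' /\ def3 N' /\ (forall v c, clo (N' v c)) /\ (forall v c, NB (N' v c)) /\
    forall v0 y, (forall c, N' v0 c y) -> forall v c, N v c y.
Proof.
elim: p k N => [|p IH] k N hm hN cN nN.
  exists k, N; do 4 split=> //.
  by move=> v0 y h v c; rewrite (_ : v = v0) //; apply: functional_extensionality => -[].
have [N1 [hm1 [hN1 [cN1 [nN1 h1]]]]] := eliminate_param hm hN cN nN.
have [k' [N' [hm' [hN' [cN' [nN' h']]]]]] := IH _ N1 hm1 hN1 cN1 nN1.
exists k', N'; do 4 split=> //.
by move=> v0 y h v c; rewrite -(ext_init_last v); apply: h1 => c'; apply: h' h _ _.
Qed.

Lemma has_curve_of_compact : acc Y -> has_curve.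
Proof.
move=> aY; have dbs := def2_bs; have dcar := def1_carrier; have dcl := def2_cl.
(* Indices whose basic set misses [x] get the whole space, so that every member is a neighbourhood
   of [x]. *)
pose N (u : pt M (pdim T)) (_ : pt M 0) y := carrier T y /\ (bs u x -> cl u y).
have hN : def3 N by rewrite /N; dsolve.
have cN u c : clo (N u c).
  have [h|h] := classic (bs u x).
    have := @clo_bigcap unit (fun _ => True) (fun _ => cl u) (fun _ => clo_cl u).
    move=> [h1 h2]; split=> [y []|y hy h3] //.
    have [|w [h4 h5]] := h2 y hy; first by move=> [_ h6]; apply: h3; split=> // _; apply: h6.
    by exists w; split=> // z /h5 h6 [h7 h8]; apply: h6; split=> // _ _; apply: h8.
  by split=> [y []|y hy h3] //; case: h3; split.
have nN u c : NB (N u c).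
  have [h|h] := classic (bs u x).
    by exists u; split=> // y hy; split=> [|_]; [apply: bs_carrier hy|apply: bs_cl].
  by apply: NB_mono NB_carrier => y hy; split.
have [k' [N' [hm' [hN' [cN' [nN' h']]]]]] := eliminate_params (N := N) I hN cN nN.
pose v0 : pt M 0 := fun _ => zero.
have [|//|h] := mono_acc (a := v0) hm' _ (cN' v0) (nN' v0) HYD HYclo (fun y h => h) aY.
  by dsolve.
(* The point [y <> x] lies in all closed basic neighbourhoods of [x], hence by regularity in all
   basic ones, and the constant family at [y] suffices. *)
have [u0 hu0] := bs_ex Hx; have [y [_ [[Yy hy] hyx]]] := h u0 hu0.
have hyN := h' v0 y hy.
apply: (@has_curve_of_family (fun _ z => z = y)); first by dsolve.
  by move=> _ z ->; split=> //; apply: HYC.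
move=> u hu; exists zero; split; first by exists y.
move=> _ ->; have [v [hv hvu]] := regular_cl hu; apply: hvu.
by case: (hyN v v0) => _; apply.
Qed.

End Definability.

Theorem theorem4p14 (M : Type) (lt : M -> M -> Prop) (add : M -> M -> M)
    (zero : M) (D : forall n, (pt M n -> Prop) -> Prop) :
  ordered_group lt add zero ->
  dense_no_endpoints lt ->
  is_structure lt add D ->
  locally_o_minimal lt D ->
  definably_complete lt D ->
  forall T : dtop M,
    is_dts D T -> regular T -> locally_def_compact D T ->
  forall C : pt M (dim T) -> Prop,
    D _ C -> (forall y, C y -> carrier T y) -> closed_in T (carrier T) C ->
  forall x : pt M (dim T), C x -> ~ isolated_in T C x ->
  exists g : M -> pt M (dim T),
    def_curve lt zero D g /\
    (forall t, lt zero t -> C (g t) /\ g t <> x) /\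
    (conv_left lt zero D T g x \/ conv_right lt zero D T g x).
Proof.
move=> OG DN ST LO DC T HT Hreg Hloc C HC HCcar [_ Hclo] x HCx Hiso.
have Hx := HCcar x HCx.
have accC : acc x C.
  move=> u [hu1 hu2]; apply: NNPP => hn; apply: Hiso; exists u; do 2 split=> //.
  by move=> y hy Cy; apply: NNPP => hyx; apply: hn; exists y.
have cC : clo C.
  split=> // y hy hCy; have [u [h1 [h2 h3]]] := Hclo y hy hCy.
  by exists u; split=> // z hz; apply: h3; [case: hz|apply: bs_carrier HT _ _ hz].
have [K [HK [HKcar [/nbhd_NB [u [hu huK]] HKC]]]] := Hloc x Hx.
(* Regularity places a closed neighbourhood [cl v] inside the compact [K]; the argument then runs in
   [C] intersected with [cl v], where [x] is still not isolated. *)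
have [v [hv hvu]] := regular_cl HT Hreg hu.
apply: (has_curve_of_compact OG DN ST LO DC HT Hreg Hx accC HKC
  (Y := fun y => C y /\ cl v y)) => //.
- exact: (def1_and_cl ST HT v HC).
- by apply: clo_and => //; apply: clo_cl.
- by move=> y [].
- by move=> y [_ /hvu /huK].
by apply: (acc_NB HT accC); exists v; split=> // y; apply: bs_cl HT _ _.
Qed.
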